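(* Let $\alpha>1$ and $\rho=(\alpha-1)/2$. Put $$r_\alpha(t)=\zeta(1+t)^\alpha-1-t^{-\alpha},\qquad t>0,$$ let $R_\alpha$ be the integral operator on $L^2(\mathbb R_+)$ with kernel $(xy)^\rho r_\alpha(x+y)$, and define the differential operator $$P_\rho=\frac{d}{dx}-\frac{\rho}{x}.$$ For every integer $N\ge1$ and every $0\le\delta<\alpha/2$, if $u\in L^2(\mathbb R_+)$ satisfies $x^{-N+1-\delta}u\in L^2(\mathbb R_+)$, then $$x^{-\delta}P_\rho^NR_\alpha u\in L^2(\mathbb R_+).$$ Moreover, $x^NP_\rho^NR_\alpha$ is bounded on $L^2(\mathbb R_+)$ for every integer $N\ge1$.
   Context: $\mathbb R_+=(0,\infty)$; $\zeta$ is the Riemann zeta function; $x^\gamma$ denotes multiplication by the function $x\mapsto x^\gamma$. *)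

(* Defs.v *)
From HB Require Import structures.
From mathcomp Require Import all_boot all_order all_algebra.
From mathcomp Require Import complex.
From mathcomp Require Import all_classical all_reals all_analysis.

Set Implicit Arguments.
Unset Strict Implicit.
Unset Printing Implicit Defensive.

Import Order.TTheory GRing.Theory Num.Theory.
Import numFieldNormedType.Exports.

Local Open Scope classical_set_scope.
Local Open Scope complex_scope.
Local Open Scope ring_scope.

Section Definitions.
Context {R : realType}.

Definition Rplus : set R := `]0, +oo[.

(* L^2(R_+) is the space of complex-valued functions. An element is given by a
   representative [R -> R[i]], of which only the values on [Rplus] matter. *)

Definition L2norm (u : R -> R[i]) : \bar R :=
  ('N[lebesgue_measure]_2%:E[(fun x => (Normc.normc (u x))%:E) \_ Rplus])%E.

Definition inL2 (u : R -> R[i]) : Prop :=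
  [/\ measurable_fun Rplus (fun x => complex.Re (u x)),
      measurable_fun Rplus (fun x => complex.Im (u x)) &
      (L2norm u < +oo)%E].

Definition bounded_on_L2 (T : (R -> R[i]) -> (R -> R[i])) : Prop :=
  exists C : R, forall u, inL2 u ->
    inL2 (T u) /\ (L2norm (T u) <= C%:E * L2norm u)%E.

Definition Cintegrable (D : set R) (f : R -> R[i]) : Prop :=
  lebesgue_measure.-integrable D (fun x => (complex.Re (f x))%:E) /\
  lebesgue_measure.-integrable D (fun x => (complex.Im (f x))%:E).

Definition Cintegral (D : set R) (f : R -> R[i]) : R[i] :=
  Rintegral lebesgue_measure D (fun x => complex.Re (f x)) +i*
  Rintegral lebesgue_measure D (fun x => complex.Im (f x)).

(* Differentiation of complex-valued functions of a real variable. *)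

Definition Cderivable (f : R -> R[i]) (x : R) : Prop :=
  derivable (fun y => complex.Re (f y)) x 1 /\
  derivable (fun y => complex.Im (f y)) x 1.

Definition Cderive (f : R -> R[i]) (x : R) : R[i] :=
  derive1 (fun y => complex.Re (f y)) x +i* derive1 (fun y => complex.Im (f y)) x.

(* Dirichlet series: this is the Riemann zeta function for s > 1, the only range
   in which it is evaluated below. *)
Definition zeta (s : R) : R := limn (series (riemannR s)).

Definition r_ (alpha t : R) : R :=
  zeta (1 + t) `^ alpha - 1 - t `^ (- alpha).

Definition rho_ (alpha : R) : R := (alpha - 1) / 2.

Definition kernelR (alpha x y : R) : R :=
  (x * y) `^ rho_ alpha * r_ alpha (x + y).

Definition opR (alpha : R) (u : R -> R[i]) (x : R) : R[i] :=
  Cintegral Rplus (fun y => (kernelR alpha x y)%:C * u y).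

Definition opP (rho : R) (f : R -> R[i]) (x : R) : R[i] :=
  Cderive f x - (rho / x)%:C * f x.

End Definitions.

(* Main.v *)
Require Import Defs.
From HB Require Import structures.
From mathcomp Require Import all_boot all_order all_algebra.
From mathcomp Require Import complex.
From mathcomp Require Import ring lra.
From mathcomp Require Import all_classical all_reals all_analysis.
From mathcomp Require Import measurable_realfun.
Import Order.TTheory GRing.Theory Num.Theory.
Import numFieldNormedType.Exports.
Local Open Scope classical_set_scope.
Local Open Scope complex_scope.
Local Open Scope ring_scope.

Set Implicit Arguments.
Unset Strict Implicit.
Unset Printing Implicit Defensive.

(* Since P_rho (x^rho f) = x^rho f', the operator P_rho^N R_alpha has kernel
   (xy)^rho r^(N)(x+y), with r = r_alpha. Everything follows from
     |r^(N)(t)| <= C min(t^(1-alpha-N), t^(-alpha-N)).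
   For t <= 1 write r = t^-alpha ((1+e)^alpha - 1) - 1 with e = t zeta(1+t) - 1.
   Then e is the sum of the first order Taylor remainders of x |-> x^-t at the
   positive integers, hence it and all its derivatives under t d/dt are O(t).
   For t >= 1 the term zeta(1+t) - 1 decays faster than any power of t, so that
   -t^-alpha dominates.
   With m = alpha/2 - delta, the kernels of x^N P_rho^N R_alpha (delta = 0) and of
   x^-delta P_rho^N R_alpha y^(N-1+delta) are bounded by a multiple of
     (xy)^(m-1/2) / (x^m + y^m)^2,
   which is bounded on L^2 by the Schur test with weights x^-1/2 and y^-1/2. *)

(** * Calculus and symbol classes *)

Section Calculus.
Context {R : realType}.
Implicit Types (f g w : R -> R) (x y t : R) (D : set R).

Lemma MVT_between f df x y :
  (forall z, Num.min x y <= z <= Num.max x y -> is_derive z 1 f (df z)) ->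
  exists2 c, Num.min x y <= c <= Num.max x y & f y - f x = df c * (y - x).
Proof.
wlog xy : x y / x <= y => [wl|].
  have [xy|/ltW yx] := leP x y => H.
    by have := wl x y xy; rewrite min_l ?max_r//; exact.
  have := wl y x yx; rewrite min_l ?max_r// => /(_ H) [c cP E].
  by exists c => //; rewrite -opprB E -mulrN opprB.
rewrite min_l// max_r// => H.
have [||c cP E] := MVT_segment (f := f) (df := df) xy.
- by move=> z; rewrite in_itv/= => /andP[? ?]; apply: H; rewrite !ltW.
- apply: continuous_in_subspaceT => z /set_mem/=; rewrite in_itv/= => zP.
  by apply: differentiable_continuous; apply/derivable1_diffP; have [] := H _ zP.
by exists c => //; move: cP; rewrite in_itv.
Qed.

Lemma taylor1_bound f f1 f2 (a b M : R) :
  (forall z, a <= z <= b -> is_derive z 1 f (f1 z)) ->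
  (forall z, a <= z <= b -> is_derive z 1 f1 (f2 z)) ->
  (forall z, a <= z <= b -> `|f2 z| <= M) ->
  forall x y, a <= x <= b -> a <= y <= b ->
  `|f y - f x - f1 x * (y - x)| <= M * (y - x) ^+ 2.
Proof.
move=> H1 H2 HM x y xP yP.
have sub u v z : a <= u <= b -> a <= v <= b ->
    Num.min u v <= z <= Num.max u v -> a <= z <= b.
  move=> /andP[? ?] /andP[? ?]; rewrite ge_min le_max.
  by move=> /andP[/orP[] ? /orP[] ?]; lra.
have [c cP ->] : exists2 c, Num.min x y <= c <= Num.max x y &
   f y - f x = f1 c * (y - x).
  by apply: MVT_between => z zP; apply: H1; apply: sub zP.
have cab : a <= c <= b by apply: (sub x y).
have [d dP E] : exists2 d, Num.min x c <= d <= Num.max x c &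
   f1 c - f1 x = f2 d * (c - x).
  by apply: MVT_between => z zP; apply: H2; apply: sub zP.
rewrite -mulrBl E -mulrA normrM -[X in _ <= M * X]ger0_norm ?sqr_ge0// ler_pM//.
  by apply: HM; apply: (sub x c).
rewrite expr2 !normrM ler_wpM2r//.
move: cP; rewrite ge_min le_max => cP.
by have [xy|xy] := leP x y; [rewrite !ger0_norm|rewrite !ler0_norm];
  move: cP => /andP[/orP[] ? /orP[] ?]; lra.
Qed.

Lemma is_derive_quadratic f x (l C e : R) : 0 < e ->
  (forall h, `|h| < e -> `|f (x + h) - f x - l * h| <= C * h ^+ 2) ->
  is_derive x 1 f l.
Proof.
move=> e0 H.
have L : h^-1 *: (f (h *: (1:R) + x) - f x) @[h --> 0^'] --> l.
  apply/cvgrPdist_le => /= eps eps0.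
  have d0 : 0 < Num.min e (eps / (`|C| + 1)).
    by rewrite lt_min e0 divr_gt0// ltr_wpDl.
  near=> h.
  have h0 : h != 0 by near: h; exact: nbhs_dnbhs_neq.
  have : `|h| < Num.min e (eps / (`|C| + 1)).
    by near: h; apply: dnbhs0_lt.
  rewrite lt_min => /andP[he hC].
  have -> : l - h^-1 *: (f (h *: (1:R) + x) - f x) = - ((f (x + h) - f x - l * h) / h).
    by rewrite /GRing.scale/= mulr1 (addrC h); field.
  rewrite normrN normrM normfV ler_pdivrMr ?normr_gt0//.
  apply: (le_trans (H _ he)).
  rewrite -real_normK ?num_real// expr2 mulrA ler_wpM2r//.
  move: hC; rewrite ltr_pdivlMr ?ltr_wpDl// => /ltW; apply: le_trans.
  rewrite mulrC ler_wpM2l//; have := ler_norm C; lra.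
split; first by apply/cvg_ex; exists l.
exact/cvg_lim.
Unshelve. all: by end_near. Qed.

Lemma is_derive_ext f g x (l : R) : 0 < x -> (forall t, 0 < t -> f t = g t) ->
  is_derive x 1 f l -> is_derive x 1 g l.
Proof.
move=> x0 E; apply: near_eq_is_derive.
by near=> z; apply: E; near: z; exact: lt_nbhsr.
Unshelve. all: by end_near. Qed.

Lemma powR_le_endpoints (a : R) x y : 0 < x -> x <= y -> forall z, x <= z <= y ->
  z `^ a <= x `^ a + y `^ a.
Proof.
move=> x0 xy z /andP[xz zy].
have z0 : 0 < z by apply: lt_le_trans xz.
have [a0|a0] := leP 0 a.
  have H : z `^ a <= y `^ a.
    by apply: ge0_ler_powR => //; rewrite nnegrE ltW// (lt_le_trans z0).
  by rewrite (le_trans H)// lerDr powR_ge0.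
have H : z `^ a <= x `^ a.
  rewrite -[a]opprK !(powRN _ (- a)) lef_pV2 ?posrE ?powR_gt0//.
  by apply: ge0_ler_powR => //; rewrite ?nnegrE; lra.
by rewrite (le_trans H)// lerDl powR_ge0.
Qed.

Lemma is_derive_mul f g x (df dg : R) : is_derive x 1 f df -> is_derive x 1 g dg ->
  is_derive x 1 (fun t => f t * g t) (df * g x + f x * dg).
Proof.
move=> Hf Hg; have := is_deriveM Hf Hg.
by move/is_derive_eq; apply; rewrite /GRing.scale/=; ring.
Qed.

Lemma is_derive_add f g x (df dg : R) : is_derive x 1 f df -> is_derive x 1 g dg ->
  is_derive x 1 (fun t => f t + g t) (df + dg).
Proof. by move=> Hf Hg; exact: is_deriveD. Qed.

Lemma is_derive_const (c x : R) : is_derive x 1 (fun _ : R => c) 0.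
Proof. exact: is_derive_cst. Qed.

Lemma is_derive_scale f (c x df : R) : is_derive x 1 f df ->
  is_derive x 1 (fun t => c * f t) (c * df).
Proof.
move=> Hf; have := is_derive_mul (is_derive_const c x) Hf.
by move/is_derive_eq; apply; ring.
Qed.

Lemma is_derive_comp f g x (df dg : R) : is_derive x 1 g dg ->
  is_derive (g x) 1 f df -> is_derive x 1 (fun t => f (g t)) (df * dg).
Proof. by move=> Hg Hf; have := is_derive1_comp Hf Hg. Qed.
End Calculus.

Section SymbolClass.
Context {R : realType}.
Implicit Types (f g e w : R -> R) (t a b : R) (D : set R).

(* The iterates [(t d/dt)^k f], [k <= n], exist on all of [t > 0], but are only
   required to be O(w) on [D]. *)
Fixpoint symbol (n : nat) (D : set R) (w f : R -> R) : Prop :=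
  (exists C, forall t, 0 < t -> D t -> `|f t| <= C * w t) /\
  if n is n'.+1 then exists g, (forall t, 0 < t -> is_derive t 1 f (g t / t)) /\
     symbol n' D w g
  else True.

Lemma symbol_bound n D w f : symbol n D w f ->
  exists C, forall t, 0 < t -> D t -> `|f t| <= C * w t.
Proof. by case: n => [|n] []. Qed.

Lemma symbolW n D w f : symbol n.+1 D w f -> symbol n D w f.
Proof.
elim: n f => [|n IH] f; first by case=> B _; split.
by case=> B [g [dg /IH sg]]; split => //; exists g.
Qed.

Lemma eq_symbol n D w f g : (forall t, 0 < t -> f t = g t) ->
  symbol n D w f -> symbol n D w g.
Proof.
move=> E; have B : (exists C, forall t, 0 < t -> D t -> `|f t| <= C * w t) ->
    (exists C, forall t, 0 < t -> D t -> `|g t| <= C * w t).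
  by move=> [C H]; exists C => t t0 Dt; rewrite -E//; exact: H.
case: n => [|n] [/B Bg]; first by split.
move=> [h [dh sh]]; split => //; exists h; split => // t t0.
by apply: is_derive_ext (dh t t0).
Qed.

Lemma symbol_le n D w w' f C :
  (forall t, 0 < t -> D t -> 0 <= w t <= C * w' t) ->
  symbol n D w f -> symbol n D w' f.
Proof.
move=> H; elim: n f => [|n IH] f /= [[K HK] S].
  split=> //; exists (`|K| * C) => t t0 Dt; apply: (le_trans (HK t t0 Dt)).
  have /andP[w0 wC] := H t t0 Dt; rewrite -mulrA.
  apply: (@le_trans _ _ (`|K| * w t)); first by rewrite ler_wpM2r// ler_norm.
  by rewrite ler_wpM2l.
split.
  exists (`|K| * C) => t t0 Dt; apply: (le_trans (HK t t0 Dt)).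
  have /andP[w0 wC] := H t t0 Dt; rewrite -mulrA.
  apply: (@le_trans _ _ (`|K| * w t)); first by rewrite ler_wpM2r// ler_norm.
  by rewrite ler_wpM2l.
by case: S => g [dg /IH sg]; exists g.
Qed.

Lemma symbolD n D w f g :
  symbol n D w f -> symbol n D w g -> symbol n D w (fun t => f t + g t).
Proof.
have B f' g' : (exists C, forall t, 0 < t -> D t -> `|f' t| <= C * w t) ->
    (exists C, forall t, 0 < t -> D t -> `|g' t| <= C * w t) ->
    (exists C, forall t, 0 < t -> D t -> `|f' t + g' t| <= C * w t).
  move=> [C H] [C' H']; exists (C + C') => t t0 Dt.
  by rewrite mulrDl (le_trans (ler_normD _ _))// lerD ?H ?H'.
elim: n f g => [|n IH] f g /= [Bf Sf] [Bg Sg]; first by split=> //; exact: B.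
split; first exact: B.
case: Sf => f1 [df sf]; case: Sg => g1 [dg sg].
exists (fun t => f1 t + g1 t); split; last exact: IH.
by move=> t t0; rewrite mulrDl; apply: is_derive_add; [exact: df|exact: dg].
Qed.

Lemma symbolM n D w w' f g : symbol n D w f -> symbol n D w' g ->
  symbol n D (fun t => w t * w' t) (fun t => f t * g t).
Proof.
have B f' g' : (exists C, forall t, 0 < t -> D t -> `|f' t| <= C * w t) ->
    (exists C, forall t, 0 < t -> D t -> `|g' t| <= C * w' t) ->
    (exists C, forall t, 0 < t -> D t -> `|f' t * g' t| <= C * (w t * w' t)).
  move=> [C H] [C' H']; exists (C * C') => t t0 Dt.
  by rewrite normrM mulrACA ler_pM ?H ?H'.
elim: n f g => [|n IH] f g; first by move=> [Bf _] [Bg _]; split=> //; exact: B.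
move=> Sf Sg; have [Bf [f1 [df sf]]] := Sf; have [Bg [g1 [dg sg]]] := Sg.
split; first exact: B.
exists (fun t => f1 t * g t + f t * g1 t); split; last first.
  by apply: symbolD; apply: IH => //; exact: symbolW.
move=> t t0; have := is_derive_mul (df t t0) (dg t t0).
by move/is_derive_eq; apply; field; exact: lt0r_neq0.
Qed.

Lemma symbol_cst n D c : symbol n D (fun=> 1) (fun=> c).
Proof.
elim: n c => [|n IH] c; split=> //; try by exists `|c| => *; rewrite mulr1.
by exists (fun=> 0); split=> // t t0; rewrite mul0r; exact: is_derive_const.
Qed.

Lemma symbolZ n D w f c : symbol n D w f -> symbol n D w (fun t => c * f t).
Proof.
move=> sf; have := symbolM (symbol_cst n D c) sf.
by congr symbol; apply/funext => t; rewrite mul1r.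
Qed.

Lemma symbol_powR n D a : symbol n D (fun t => t `^ a) (fun t => t `^ a).
Proof.
have B : exists C, forall t, 0 < t -> D t -> `|t `^ a| <= C * t `^ a.
  by exists 1 => t _ _; rewrite mul1r ger0_norm ?powR_ge0.
elim: n => [|n IH]; split=> //.
exists (fun t => a * t `^ a); split; last exact: symbolZ.
move=> t t0; have := is_derive1_powR a t0; move/is_derive_eq; apply.
by rewrite powRB ?(gt_eqF t0) ?implybT// powRr1 ?ltW// mulrA.
Qed.

Lemma symbol_powR1D n D w e a K :
  (forall t, 0 < t -> 0 <= e t) ->
  (forall t, 0 < t -> D t -> 0 <= w t <= K) ->
  symbol n D w e -> symbol n D (fun=> 1) (fun t => (1 + e t) `^ a).
Proof.
move=> e0 wK; elim: n a => [|n IH] a se.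
- have [C H] := symbol_bound se.
  split=> //; exists (1 `^ a + (1 + `|C| * K) `^ a) => t t0 Dt; rewrite mulr1.
  rewrite ger0_norm ?powR_ge0//; apply: powR_le_endpoints => //.
    have /andP[? ?] := wK t t0 Dt.
    by rewrite lerDl mulr_ge0//; lra.
  rewrite lerDl e0//= lerD2l (le_trans (ler_norm _))// (le_trans (H t t0 Dt))//.
  have /andP[w0 wk] := wK t t0 Dt.
  apply: (@le_trans _ _ (`|C| * w t)); first by rewrite ler_wpM2r// ler_norm.
  by rewrite ler_wpM2l.
- split; first exact: symbol_bound (IH a (symbolW se)).
  case: (se) => _ [g [dg sg]].
  exists (fun t => a * ((1 + e t) `^ (a - 1) * g t)); split.
    move=> t t0; have p : 0 < 1 + e t by have := e0 t t0; lra.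
    have := is_derive_comp (is_derive_add (is_derive_const 1 t) (dg t t0))
      (is_derive1_powR a p).
    by move/is_derive_eq; apply; field; exact: lt0r_neq0.
  apply: symbolZ.
  have s1 := IH (a - 1) (symbolW se).
  have := symbolM s1 sg; apply: (@symbol_le _ _ _ _ _ K) => t t0 Dt.
  by rewrite mul1r mulr1 wK.
Qed.

Lemma symbol_powR1DB1 n D w e a K :
  (forall t, 0 < t -> 0 <= e t) ->
  (forall t, 0 < t -> D t -> 0 <= w t <= K) ->
  symbol n D w e -> symbol n D w (fun t => (1 + e t) `^ a - 1).
Proof.
move=> e0 wK se.
have p t : 0 < t -> 0 < 1 + e t by move=> /e0; lra.
have dF t : 0 < t -> is_derive t 1 (fun s => s `^ a) (a * t `^ (a - 1)).
  by move=> t0; exact: is_derive1_powR.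
have [C H] := symbol_bound se.
have B : exists C, forall t, 0 < t -> D t -> `|(1 + e t) `^ a - 1| <= C * w t.
  exists (`|a| * (1 + (1 + `|C| * K) `^ (a - 1)) * `|C|) => t t0 Dt.
  have /andP[w0 wk] := wK t t0 Dt.
  have et : e t <= `|C| * w t.
    rewrite (le_trans (ler_norm _))// (le_trans (H t t0 Dt))//.
    by rewrite ler_wpM2r// ler_norm.
  have CK : `|C| * w t <= `|C| * K by rewrite ler_wpM2l.
  have et0 := e0 t t0.
  have [|c] := @MVT_between _ (fun s => s `^ a) (fun s => a * s `^ (a - 1)) 1 (1 + e t).
    by move=> z; rewrite min_l ?lerDl// => /andP[z1 _]; apply: dF; lra.
  rewrite min_l ?lerDl// max_r ?lerDl// => /andP[c1 c2]; rewrite powR1 => ->.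
  have -> : 1 + e t - 1 = e t by ring.
  rewrite !normrM [X in _ * X <= _]ger0_norm// -!mulrA ler_wpM2l// ler_pM//.
  have := @powR_le_endpoints _ (a - 1) 1 (1 + `|C| * K) ltr01 _ c.
  rewrite powR1 ger0_norm ?powR_ge0//; apply.
    by rewrite lerDl (le_trans _ CK)// mulr_ge0.
  by rewrite c1/= (le_trans c2)// lerD2l (le_trans et).
case: n se => [|n] se; split=> //.
case: (se) => _ [g [dg sg]].
exists (fun t => a * ((1 + e t) `^ (a - 1) * g t)); split.
  move=> t t0.
  have D1e := is_derive_add (is_derive_const 1 t) (dg t t0).
  have := is_derive_add (is_derive_comp D1e (is_derive1_powR a (p t t0)))
    (is_derive_const (- 1) t).
  by move/is_derive_eq; apply; field; exact: lt0r_neq0.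
apply: symbolZ.
have := symbolM (symbol_powR1D (a - 1) e0 wK (symbolW se)) sg.
by congr symbol; apply/funext => t; rewrite mul1r.
Qed.

Lemma symbol_derive1 D w f : (forall n, symbol n D w f) ->
  (forall t, 0 < t -> derivable f t 1) /\
  forall n, symbol n D (fun t => w t * t `^ (-1)) (derive1 f).
Proof.
move=> S; split=> [t t0|n]; first by have [_ [g [dg _]]] := S 1%N; have [] := dg t t0.
have [_ [g [dg sg]]] := S n.+1.
have := symbolM sg (symbol_powR n D (-1)); apply: eq_symbol => t t0.
by rewrite powR_inv1 ?ltW// derive1E; have [_ ->] := dg t t0.
Qed.

Lemma symbol_derive1n D w f : (forall n, symbol n D w f) -> forall N,
  (forall t, 0 < t -> derivable (derive1n N f) t 1) /\
  forall n, symbol n D (fun t => w t * t `^ (- N%:R)) (derive1n N f).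
Proof.
move=> S N.
suff H : forall n, symbol n D (fun t => w t * t `^ (- N%:R)) (derive1n N f).
  by split=> //; have [] := symbol_derive1 H.
elim: N => [|N IH] n.
  have := S n; congr symbol; apply/funext => t.
  by rewrite oppr0 powRr0 mulr1.
have [_ /(_ n)] := symbol_derive1 IH; rewrite derive1nS.
congr symbol; apply/funext => t; rewrite -mulrA -powRD; last first.
  by rewrite -opprD oppr_eq0 natr1 pnatr_eq0.
by rewrite -opprD natr1.
Qed.
End SymbolClass.

(** * Termwise differentiation of series *)

Section Series.
Context {R : realType}.
Implicit Types (u v : nat -> R).

Lemma series_norm_le u v : (forall n, `|u n| <= v n) -> cvgn (series v) ->
  cvgn (series u) /\ `|limn (series u)| <= limn (series v).
Proof.
move=> uv cv.
have cn : cvgn [normed series u].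
  have v0 n : 0 <= v n by exact: le_trans (normr_ge0 _) (uv n).
  exact: (@series_le_cvg _ (fun n => `|u n|) v).
have cu : cvgn (series u) by exact: normed_cvg.
split=> //; apply: (le_trans (lim_series_norm cn)).
exact: lim_series_le.
Qed.

Lemma series_lin2 u v (a b : R) : cvgn (series u) -> cvgn (series v) ->
  cvgn (series (fun n => a * u n + b * v n)) /\
  limn (series (fun n => a * u n + b * v n)) =
  a * limn (series u) + b * limn (series v).
Proof.
move=> cu cv.
have E : (fun n => a * u n + b * v n) = (a *: u + b *: v) by apply/funext.
have cau : cvgn (series (a *: u)) by exact: is_cvg_seriesZ.
have cbv : cvgn (series (b *: v)) by exact: is_cvg_seriesZ.
rewrite E; split; first exact: is_cvg_seriesD.
rewrite (lim_seriesD cau cbv); congr (_ + _); exact: lim_seriesZ.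
Qed.

Lemma cvg_series_zeta (c : R) : 0 < c ->
  cvgn (series (fun n => n.+1%:R `^ (- 1 - c))).
Proof.
move=> c0; apply: nondecreasing_is_cvgn.
  by apply: nondecreasing_series => n _ _; exact: powR_ge0.
suff H N : series (fun n => n.+1%:R `^ (- 1 - c)) N.+1 <= 1 + (1 - N.+1%:R `^ (- c)) / c.
  exists (1 + c^-1) => _ [N _ <-].
  apply: (@le_trans _ _ (series (fun n => n.+1%:R `^ (- 1 - c)) N.+1)).
    by rewrite seriesSr lerDl powR_ge0.
  rewrite (le_trans (H N))// lerD2l mulrBl mul1r gerBl.
  by rewrite divr_ge0 ?powR_ge0 ?ltW.
elim: N => [|N IH]; first by rewrite seriesSr /series/= big_geq// add0r !powR1 subrr mul0r addr0.
rewrite seriesSr (le_trans (lerD IH (lexx _)))//.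
rewrite -addrA lerD2l -lerBrDl -mulrBl.
have -> : 1 - N.+2%:R `^ (- c) - (1 - N.+1%:R `^ (- c)) =
   - (N.+2%:R `^ (- c) - N.+1%:R `^ (- c)) :> R by ring.
have [|d] := @MVT_between _ (fun s : R => s `^ (- c))
    (fun s => (- c) * s `^ (- c - 1)) N.+1%:R N.+2%:R.
  move=> z; rewrite min_l ?ler_nat// => /andP[z1 _]; apply: is_derive1_powR.
  by apply: lt_le_trans z1; rewrite ltr0n.
rewrite min_l ?max_r ?ler_nat// => /andP[d1 d2] ->.
have -> : N.+2%:R - N.+1%:R = 1 :> R by rewrite -natrB// subSnn.
have -> X : - (- c * X * 1) / c = X by field; rewrite gt_eqF.
rewrite (addrC (- c)).
have d0 : 0 < d by apply: lt_le_trans d1; rewrite ltr0n.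
rewrite -opprD !powRN lef_pV2 ?posrE ?powR_gt0 ?ltr0n//.
by apply: ge0_ler_powR; rewrite ?nnegrE//; lra.
Qed.

Lemma symbol_series (D : set R) (w : R -> R) (f : nat -> nat -> R -> R) :
  (forall k n (t : R), 0 < t -> is_derive t 1 (f k n) (f k.+1 n t / t)) ->
  (forall k (a b : R), 0 < a -> exists2 M : nat -> R, cvgn (series M) &
      forall n t, a <= t <= b -> `|f k n t| <= M n) ->
  (forall k, exists2 M : nat -> R, cvgn (series M) &
      forall n t, 0 < t -> D t -> `|f k n t| <= M n * w t) ->
  forall m k, symbol m D w (fun t => limn (series (fun n => f k n t))).
Proof.
move=> df loc bnd.
have B k : exists C, forall t, 0 < t -> D t ->
    `|limn (series (fun n => f k n t))| <= C * w t.
  have [M cM HM] := bnd k; exists (limn (series M)) => t t0 Dt.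
  have [c1] := series_lin2 (w t) 0 cM cM; rewrite mul0r addr0 => E.
  have [||_] := @series_norm_le (fun n => f k n t) (fun n => w t * M n + 0 * M n).
  - by move=> n; rewrite mul0r addr0 mulrC HM.
  - exact: c1.
  - by rewrite E mulrC.
elim=> [|m IH] k; first by split.
split=> //; exists (fun t => limn (series (fun n => f k.+1 n t))); split=> // t t0.
set a := t / 2; set b := 2 * t.
have a0 : 0 < a by rewrite divr_gt0.
have [M0 cM0 H0] := loc k a b a0.
have [M1 cM1 H1] := loc k.+1 a b a0.
have [M2 cM2 H2] := loc k.+2 a b a0.
pose G n := (a ^- 2) * M2 n + a ^- 2 * M1 n.
have [cG _] := series_lin2 (a ^- 2) (a ^- 2) cM2 cM1.
have tab : a <= t <= b by rewrite /a /b; lra.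
have cv j s : a <= s <= b -> cvgn (series (fun n => f j n s)).
  move=> sab; have [M cM HM] := loc j a b a0.
  by have [] := @series_norm_le (fun n => f j n s) M (fun n => HM n s sab) cM.
apply: (@is_derive_quadratic _ _ _ _ (limn (series G)) a a0) => h.
rewrite ltr_norml => /andP[h1 h2].
have thab : a <= t + h <= b by rewrite /b /a in h1 h2 *; lra.
have [cL1 E1] := series_lin2 1 (- 1) (cv k _ thab) (cv k _ tab).
have [cL2 E2] := series_lin2 1 (- h / t) cL1 (cv k.+1 _ tab).
have [cG2 EG] := series_lin2 (h ^+ 2) 0 cG cG.
have HG n : `|1 * (1 * f k n (t + h) + -1 * f k n t) + - h / t * f k.+1 n t| <=
    h ^+ 2 * G n + 0 * G n.
  have -> : 1 * (1 * f k n (t + h) + -1 * f k n t) + - h / t * f k.+1 n t =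
     f k n (t + h) - f k n t - f k.+1 n t / t * (t + h - t).
    by field; exact: lt0r_neq0.
  have -> : h ^+ 2 * G n + 0 * G n = G n * (t + h - t) ^+ 2 by ring.
  have P1 z : a <= z <= b -> is_derive z 1 (f k n) (f k.+1 n z / z).
    by move=> /andP[az _]; apply: df; exact: lt_le_trans az.
  have P2 z : a <= z <= b -> is_derive z 1 (fun s => f k.+1 n s / s)
      ((f k.+2 n z - f k.+1 n z) / z ^+ 2).
    move=> /andP[az _]; have z0 : 0 < z by exact: lt_le_trans az.
    have := is_derive_mul (df k.+1 n z z0) (is_derive1_powR (- 1) z0).
    move/(is_derive_ext (g := (fun s => f k.+1 n s / s)) z0).
    have E s : 0 < s -> f k.+1 n s * s `^ (- 1) = f k.+1 n s / s.
      by move=> s0; rewrite powR_inv1// ltW.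
    move/(_ E)/is_derive_eq; apply.
    have -> : -1 - 1 = - 2%:R :> R by rewrite -opprD.
    by rewrite powR_inv1 ?powR_invn ?ltW//; field; exact: lt0r_neq0.
  have P3 z : a <= z <= b -> `|(f k.+2 n z - f k.+1 n z) / z ^+ 2| <= G n.
    move=> zab; have /andP[az _] := zab.
    rewrite /G -mulrDr normrM mulrC ler_pM//.
      have z0 : 0 < z by exact: lt_le_trans az.
      rewrite ger0_norm ?invr_ge0 ?sqr_ge0// lef_pV2 ?posrE ?exprn_gt0//.
      by rewrite ler_pXn2r ?nnegrE// ltW.
    by rewrite (le_trans (ler_normB _ _))// lerD ?H1 ?H2.
  exact: (taylor1_bound P1 P2 P3 tab thab).
have [_] := series_norm_le HG cG2.
rewrite EG E2 E1 mul0r addr0 [X in _ <= X]mulrC; apply: le_trans.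
rewrite le_eqVlt; apply/orP; left; apply/eqP; congr `|_|.
by field; exact: lt0r_neq0.
Qed.
End Series.

(** * Derivatives of the zeta function *)

Section PolyExp.
Context {R : realType}.
Implicit Types (p q : {poly R}) (s t x : R).

Definition polyexp p s := p.[s] * expR (- s).

Definition polyexp_deriv p : {poly R} := (deriv p - p)%R.

Definition polyexp_euler p : {poly R} := 'X * polyexp_deriv p.

Lemma polyexpX p s : polyexp ('X * p) s = s * polyexp p s.
Proof. by rewrite /polyexp hornerM hornerX mulrA. Qed.

Lemma is_derive_polyexp p s : is_derive s 1 (polyexp p) (polyexp (polyexp_deriv p) s).
Proof.
have E := is_derive_comp (is_derive_scale (-1) (is_derive_id s (1 : R))) (is_derive_expR (-1 * s)).
have := is_derive_mul (is_derive_poly p s) E.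
rewrite (_ : (fun t => _) = polyexp p); last first.
  by apply/funext => t; rewrite /polyexp mulN1r.
move/is_derive_eq; apply; rewrite /polyexp /polyexp_deriv hornerD hornerN mulN1r.
by ring.
Qed.

Lemma poly_le_expR p (c : R) : 0 < c ->
  exists2 C : R, 0 <= C & forall s, 0 <= s -> `|p.[s]| <= C * expR (c * s).
Proof.
elim/poly_ind: p c => [|p a IH] c c0.
  by exists 0 => // s _; rewrite horner0 normr0 mul0r.
have c20 : 0 < c / 2 by rewrite divr_gt0.
have [C C0 HC] := IH _ c20.
exists (C * (2 / c) + `|a|); first by rewrite addr_ge0// mulr_ge0// divr_ge0// ltW.
move=> s s0; rewrite hornerMXaddC (le_trans (ler_normD _ _))// mulrDl lerD//; last first.
  by rewrite ler_peMr// -expR0 ler_expR mulr_ge0// ltW.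
rewrite normrM (ger0_norm s0).
have -> : expR (c * s) = expR (c / 2 * s) * expR (c / 2 * s).
  by rewrite -expRD; congr expR; field.
set e := expR _.
have -> : C * (2 / c) * (e * e) = C * e * (2 / c * e) by ring.
rewrite ler_pM// ?HC//.
have E : s = 2 / c * (c / 2 * s) by field; rewrite gt_eqF.
apply: (@le_trans _ _ (2 / c * (c / 2 * s))); first by rewrite -E.
rewrite ler_wpM2l ?divr_ge0 ?(ltW c0)//.
by have := expR_ge1Dx (c / 2 * s); rewrite -/e; lra.
Qed.

Lemma polyexp_bound p : exists2 C : R, 0 <= C &
  forall s, 0 <= s -> `|polyexp p s| <= C * expR (- (s / 2)).
Proof.
have h : 0 < 2^-1 :> R by [].
have [C C0 H] := poly_le_expR p h; exists C => // s s0.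
rewrite /polyexp normrM (ger0_norm (expR_ge0 _)).
have -> : expR (- (s / 2)) = expR (2^-1 * s) * expR (- s).
  by rewrite -expRD; congr expR; field.
by rewrite mulrA ler_wpM2r ?expR_ge0// H.
Qed.

Lemma polyexp_bound_power p m : exists2 C : R, 0 <= C &
  forall s, 0 < s -> `|polyexp p s| <= C * expR (- (s / 2)) * s ^- m.
Proof.
have [C C0 H] := polyexp_bound ('X^m * p); exists C => // s s0.
rewrite ler_pdivlMr ?exprn_gt0// mulrC.
have := H s (ltW s0); rewrite /polyexp hornerM hornerXn -mulrA normrM.
by rewrite [X in X * _]ger0_norm// exprn_ge0// ltW.
Qed.

(* With [theta = t d/dt], [theta^k (x^-t) = polyexp (theta_poly k) (t * ln x)]. *)
Definition theta_poly k : {poly R} := iter k polyexp_euler 1.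

Lemma theta_polyS k : theta_poly k.+1 = 'X * polyexp_deriv (theta_poly k).
Proof. by []. Qed.

Lemma is_derive_polyexp_scale p (c t : R) : 0 < t ->
  is_derive t 1 (fun t => polyexp p (t * c)) (polyexp (polyexp_euler p) (t * c) / t).
Proof.
move=> t0.
have D := is_derive_scale c (is_derive_id t (1 : R)).
have := is_derive_comp D (is_derive_polyexp p (c * t)).
rewrite (_ : (fun t => _) = (fun t => polyexp p (t * c))); last first.
  by apply/funext => u /=; rewrite mulrC.
move/is_derive_eq; apply; rewrite polyexpX (mulrC t c).
by field; exact: lt0r_neq0.
Qed.

Lemma is_derive_polyexp_ln p (t x : R) : 0 < x ->
  is_derive x 1 (fun x => polyexp p (t * ln x))
    (t / x * polyexp (polyexp_deriv p) (t * ln x)).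
Proof.
move=> x0; have D := is_derive_scale t (is_derive1_ln x0).
have := is_derive_comp D (is_derive_polyexp p (t * ln x)).
by move/is_derive_eq; apply; ring.
Qed.

Lemma polyexp1_ln t x : 0 < x -> polyexp 1 (t * ln x) = x `^ (- t).
Proof. by move=> x0; rewrite /polyexp hornerC mul1r /powR gt_eqF// mulNr. Qed.

Lemma expR_ln_powR (c x : R) : 0 < x -> expR (c * ln x) = x `^ c.
Proof. by move=> x0; rewrite /powR gt_eqF. Qed.
End PolyExp.

Section ZetaSmall.
Context {R : realType}.
Implicit Types (t x : R).

(* [t n^(-1-t) - (n^-t - (n+1)^-t)] and its Euler derivatives: a first order
   Taylor remainder of [x |-> x^-t], so that the sum over [n] is O(t). *)
Definition zeta_defect k n t : R :=
  polyexp (theta_poly k) (t * ln n.+2%:R) - polyexp (theta_poly k) (t * ln n.+1%:R)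
  - t / n.+1%:R * polyexp (polyexp_deriv (theta_poly k)) (t * ln n.+1%:R).

Lemma is_derive_zeta_defect k n t : 0 < t ->
  is_derive t 1 (zeta_defect k n) (zeta_defect k.+1 n t / t).
Proof.
move=> t0.
have D1 := is_derive_polyexp_scale (theta_poly k) (ln n.+2%:R) t0.
have D2 := is_derive_polyexp_scale (theta_poly k) (ln n.+1%:R) t0.
have D3 := is_derive_polyexp_scale (polyexp_deriv (theta_poly k)) (ln n.+1%:R) t0.
have D4 := is_derive_mul (is_derive_scale n.+1%:R^-1 (is_derive_id t (1 : R))) D3.
have := is_derive_add (is_derive_add D1 (is_derive_scale (-1) D2)) (is_derive_scale (-1) D4).
rewrite (_ : (fun t => _) = zeta_defect k n); last first.
  by apply/funext => u /=; rewrite /zeta_defect; field.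
move/is_derive_eq; apply; rewrite /zeta_defect.
have -> : polyexp_deriv (@theta_poly R k.+1) =
    polyexp_deriv (theta_poly k) + 'X * polyexp_deriv (polyexp_deriv (theta_poly k)).
  rewrite theta_polyS; set d := polyexp_deriv (theta_poly k).
  by rewrite /polyexp_deriv derivM derivX mul1r; ring.
have -> (a b : {poly R}) s : polyexp (a + 'X * b) s = polyexp a s + s * polyexp b s.
  by rewrite -polyexpX /polyexp hornerD mulrDl.
rewrite theta_polyS /polyexp_euler !polyexpX.
have : (n.+1%:R : R) != 0 by rewrite pnatr_eq0.
by move: (n.+1%:R : R) => m m0; field; rewrite m0 gt_eqF.
Qed.

Lemma zeta_defect_bound k : exists2 C : R, 0 <= C & forall n t, 0 < t ->
  `|zeta_defect k n t| <= C * (t + t ^+ 2) * n.+1%:R `^ (- 1 - 1).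
Proof.
set p := @theta_poly R k.
have [C1 C10 H1] := polyexp_bound (polyexp_deriv p).
have [C2 C20 H2] := polyexp_bound (polyexp_deriv (polyexp_deriv p)).
exists (C1 + C2); first exact: addr_ge0.
move=> n t t0; have t0W := ltW t0; set a : R := n.+1%:R; set b : R := n.+2%:R.
have a0 : 0 < a by rewrite ltr0n.
have ab : a <= b by rewrite ler_nat.
have ba : b - a = 1 by rewrite -natrB// subSnn.
have P1 z : a <= z <= b -> is_derive z 1 (fun x => polyexp p (t * ln x))
    (t / z * polyexp (polyexp_deriv p) (t * ln z)).
  by move=> /andP[az _]; apply: is_derive_polyexp_ln; exact: lt_le_trans az.
have P2 z : a <= z <= b ->
   is_derive z 1 (fun x => t / x * polyexp (polyexp_deriv p) (t * ln x))
    (t ^+ 2 / z ^+ 2 * polyexp (polyexp_deriv (polyexp_deriv p)) (t * ln z)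
     - t / z ^+ 2 * polyexp (polyexp_deriv p) (t * ln z)).
  move=> /andP[az _]; have z0 : 0 < z by exact: lt_le_trans az.
  have D1 := is_derive_scale t (is_derive1_powR (-1) z0).
  have D2 := is_derive_polyexp_ln (polyexp_deriv p) t z0.
  have := is_derive_mul D1 D2.
  have E s : 0 < s -> t * s `^ (- 1) * polyexp (polyexp_deriv p) (t * ln s) =
       t / s * polyexp (polyexp_deriv p) (t * ln s).
    by move=> s0; rewrite powR_inv1// ltW.
  move/(is_derive_ext (g := (fun x => t / x * polyexp (polyexp_deriv p) (t * ln x))) z0).
  move/(_ E)/is_derive_eq; apply.
  have -> : -1 - 1 = - 2%:R :> R by rewrite -opprD.
  by rewrite powR_inv1 ?powR_invn ?ltW//; field; exact: lt0r_neq0.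
have W z C (q : {poly R}) : a <= z -> 0 <= C ->
   (forall s, 0 <= s -> `|polyexp q s| <= C * expR (- (s / 2))) ->
   `|polyexp q (t * ln z)| <= C.
  move=> az C0 H; have s0 : 0 <= t * ln z.
    by rewrite mulr_ge0 ?(ltW t0)// ln_ge0// (le_trans _ az)// ler1n.
  rewrite (le_trans (H _ s0))// ler_piMr// -expR0 ler_expR oppr_le0.
  by rewrite divr_ge0.
have P3 z : a <= z <= b ->
    `|t ^+ 2 / z ^+ 2 * polyexp (polyexp_deriv (polyexp_deriv p)) (t * ln z)
     - t / z ^+ 2 * polyexp (polyexp_deriv p) (t * ln z)| <=
    (C1 + C2) * (t + t ^+ 2) * a `^ (- 1 - 1).
  move=> /andP[az _]; have z0 : 0 < z by exact: lt_le_trans az.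
  have za : (z ^+ 2)^-1 <= a `^ (- 1 - 1).
    have -> : -1 - 1 = - 2%:R :> R by rewrite -opprD.
    rewrite (powR_invn _ (ltW a0)) lef_pV2 ?posrE ?exprn_gt0//.
    by rewrite ler_pXn2r ?nnegrE ?(ltW z0) ?(ltW a0).
  have z20 : 0 <= (z ^+ 2)^-1 by rewrite invr_ge0 sqr_ge0.
  have w1 := W z _ _ az C10 H1; have w2 := W z _ _ az C20 H2.
  rewrite (le_trans (ler_normB _ _))// (normrM (t ^+ 2 / _)) (normrM (t / _)).
  rewrite (@ger0_norm _ (t ^+ 2 / _)) ?mulr_ge0 ?sqr_ge0//.
  rewrite (@ger0_norm _ (t / _)) ?mulr_ge0 ?(ltW t0)//.
  have n1 := normr_ge0 (polyexp (polyexp_deriv p) (t * ln z)).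
  have n2 := normr_ge0 (polyexp (polyexp_deriv (polyexp_deriv p)) (t * ln z)).
  apply: (@le_trans _ _ ((C1 + C2) * (t + t ^+ 2) * (z ^+ 2)^-1)); last first.
    by rewrite ler_wpM2l// mulr_ge0 ?addr_ge0 ?sqr_ge0// ltW.
  set n2' := `|_|; set n1' := `|_|.
  have -> : t ^+ 2 / z ^+ 2 * n2' + t / z ^+ 2 * n1' =
     (t ^+ 2 * n2' + t * n1') / z ^+ 2 by ring.
  rewrite ler_wpM2r//; apply: (@le_trans _ _ (t ^+ 2 * C2 + t * C1)).
    by rewrite lerD// ler_wpM2l// ?sqr_ge0// ltW.
  have := mulr_ge0 (ltW t0) C20; have := mulr_ge0 (sqr_ge0 t) C10.
  by lra.
have := taylor1_bound P1 P2 P3 (x := a) (y := b).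
by rewrite !lexx ab ba expr1n !mulr1 => /(_ isT isT).
Qed.
End ZetaSmall.

Section ZetaSymbol.
Context {R : realType}.
Implicit Types (t x a : R).

Lemma symbol_zeta_defect m :
  symbol m [set t : R | t <= 1] id (fun t => limn (series (fun n => zeta_defect 0 n t))).
Proof.
have cz := @cvg_series_zeta R 1 ltr01.
apply: (@symbol_series _ _ _ zeta_defect) => [k n t t0|k a b a0|k].
- exact: is_derive_zeta_defect.
- have [C C0 H] := @zeta_defect_bound R k.
  exists (fun n => C * (b + b ^+ 2) * n.+1%:R `^ (- 1 - 1) + 0 * n.+1%:R `^ (- 1 - 1)).
    by have [] := series_lin2 (C * (b + b ^+ 2)) 0 cz cz.
  move=> n t /andP[at_ tb]; have t0 : 0 < t by exact: lt_le_trans at_.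
  rewrite mul0r addr0 (le_trans (H n t t0))// ler_wpM2r ?powR_ge0// ler_wpM2l//.
  by rewrite lerD// ler_pXn2r ?nnegrE//; lra.
- have [C C0 H] := @zeta_defect_bound R k.
  exists (fun n => C * 2 * n.+1%:R `^ (- 1 - 1) + 0 * n.+1%:R `^ (- 1 - 1)).
    by have [] := series_lin2 (C * 2) 0 cz cz.
  move=> n t t0 /= t1; rewrite mul0r addr0 (le_trans (H n t t0))//.
  have -> : C * 2 * n.+1%:R `^ (-1 - 1) * t = C * (t + t) * n.+1%:R `^ (-1 - 1) by ring.
  by rewrite ler_wpM2r ?powR_ge0// ler_wpM2l// lerD2l expr2 ler_piMr ?(ltW t0).
Qed.

Lemma cvg_series_defect t : 0 < t -> cvgn (series (fun n => zeta_defect 0 n t)).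
Proof.
move=> t0; have [C C0 H] := @zeta_defect_bound R 0.
have cz := @cvg_series_zeta R 1 ltr01.
have [c _] := series_lin2 (C * (t + t ^+ 2)) 0 cz cz.
have [|//] := @series_norm_le _ (fun n => zeta_defect 0 n t) _ _ c.
by move=> n; rewrite mul0r addr0; exact: H.
Qed.

Lemma riemannR_polyexp t n :
  riemannR (1 + t) n = n.+1%:R^-1 * polyexp 1 (t * ln n.+1%:R).
Proof.
rewrite /riemannR polyexp1_ln ?ltr0n// -powRN opprD powRD; last first.
  by rewrite pnatr_eq0 implybT.
by rewrite powR_inv1.
Qed.

Lemma cvg_series_riemannR t : 0 < t -> cvgn (series (riemannR (1 + t))).
Proof.
move=> t0; rewrite (_ : riemannR _ = fun n => n.+1%:R `^ (- 1 - t)).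
  exact: cvg_series_zeta.
by apply/funext => n; rewrite /riemannR -powRN opprD.
Qed.

Lemma zeta_defect0E t n : zeta_defect 0 n t =
  n.+2%:R `^ (- t) - n.+1%:R `^ (- t) + t * riemannR (1 + t) n.
Proof.
rewrite riemannR_polyexp -!polyexp1_ln ?ltr0n// /zeta_defect/= /polyexp_deriv.
have -> : deriv 1 - 1 = - 1 :> {poly R} by rewrite -polyC1 derivC sub0r.
have -> s : polyexp (- 1) s = - polyexp 1 s :> R.
  by rewrite /polyexp hornerN mulNr.
by rewrite mulrN opprK -mulrA.
Qed.

Lemma zeta_defect0_ge0 t n : 0 < t -> 0 <= zeta_defect 0 n t.
Proof.
move=> t0; rewrite zeta_defect0E.
have [|d] := @MVT_between _ (fun s : R => s `^ (- t))
    (fun s => (- t) * s `^ (- t - 1)) n.+1%:R n.+2%:R.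
  move=> z; rewrite min_l ?ler_nat// => /andP[z1 _]; apply: is_derive1_powR.
  by apply: lt_le_trans z1; rewrite ltr0n.
rewrite min_l ?max_r ?ler_nat// => /andP[d1 d2] ->.
have -> : n.+2%:R - n.+1%:R = 1 :> R by rewrite -natrB// subSnn.
rewrite mulr1 mulNr addrC subr_ge0 ler_wpM2l ?(ltW t0)//.
rewrite /riemannR -opprD powRN (addrC t) lef_pV2 ?posrE ?powR_gt0 ?ltr0n//; last first.
  by apply: lt_le_trans d1; rewrite ltr0n.
apply: ge0_ler_powR; rewrite ?nnegrE//; first by lra.
by rewrite (le_trans _ d1).
Qed.

Lemma series_zeta_defect t N : series (fun n => zeta_defect 0 n t) N =
  N.+1%:R `^ (- t) - 1 + t * series (riemannR (1 + t)) N.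
Proof.
elim: N => [|N IH]; first by rewrite /series/= !big_geq// powR1 subrr mulr0 addr0.
by rewrite !seriesSr /= IH zeta_defect0E; ring.
Qed.

Lemma cvg_powRN t : 0 < t -> (n.+1%:R `^ (- t) : R) @[n --> \oo] --> 0.
Proof.
move=> t0; apply/cvgrPdist_le => e e0; near=> n.
rewrite sub0r normrN ger0_norm ?powR_ge0// powRN.
rewrite -[leRHS]invrK lef_pV2 ?posrE ?powR_gt0 ?ltr0n ?invr_gt0//.
have -> : e^-1 = (e^-1 `^ (t^-1)) `^ t.
  by rewrite -powRrM mulVf ?gt_eqF// powRr1// invr_ge0 ltW.
apply: ge0_ler_powR; rewrite ?nnegrE ?powR_ge0 ?(ltW t0)//.
apply: (@le_trans _ _ n%:R); last by rewrite ler_nat.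
near: n; exact: nbhs_infty_ger.
Unshelve. all: by end_near. Qed.

Lemma sum_zeta_defect t : 0 < t ->
  limn (series (fun n => zeta_defect 0 n t)) = t * zeta (1 + t) - 1.
Proof.
move=> t0; apply/cvg_lim => //.
rewrite (_ : series _ =
  fun N => (N.+1%:R `^ (- t) - 1) + t * series (riemannR (1 + t)) N); last first.
  by apply/funext => N; exact: series_zeta_defect.
rewrite (_ : t * _ - 1 = (0 - 1) + t * zeta (1 + t)); last by ring.
apply: cvgD; first by apply: cvgB; [exact: cvg_powRN|exact: cvg_cst].
by apply: cvgMr; exact: cvg_series_riemannR.
Qed.

Lemma tzeta_sub1_ge0 t : 0 < t -> 0 <= t * zeta (1 + t) - 1.
Proof.
move=> t0; rewrite -sum_zeta_defect//; apply: limr_ge; first exact: cvg_series_defect.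
by near=> n; apply: sumr_ge0 => i _; exact: zeta_defect0_ge0.
Unshelve. all: by end_near. Qed.

Lemma symbol_zeta_le1 m :
  symbol m [set t : R | t <= 1] id (fun t => t * zeta (1 + t) - 1).
Proof.
by apply: eq_symbol (symbol_zeta_defect m) => t t0; exact: sum_zeta_defect.
Qed.

Definition zeta_tail k n t : R :=
  n.+2%:R^-1 * polyexp (theta_poly k) (t * ln n.+2%:R).

Lemma cvg_zeta_tail t : 0 < t ->
  series (fun n => zeta_tail 0 n t) @ \oo --> zeta (1 + t) - 1.
Proof.
move=> t0; rewrite (_ : series _ = fun N => series (riemannR (1 + t)) N.+1 - 1).
  apply: cvgB; last exact: cvg_cst.
  by rewrite (@cvg_shiftS _ (series (riemannR (1 + t)))); exact: cvg_series_riemannR.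
apply/funext => N; rewrite /series/= big_nat_recl//= {1}/riemannR powR1 invr1 addrC addKr.
apply: eq_bigr => i _; rewrite /zeta_tail -[RHS]/(riemannR (1 + t) i.+1).
by rewrite riemannR_polyexp.
Qed.

Lemma zeta_sub1_ge0 t : 0 < t -> 0 <= zeta (1 + t) - 1.
Proof.
move=> t0; have C := cvg_zeta_tail t0; rewrite -(cvg_lim _ C)//.
apply: limr_ge; first by apply/cvg_ex; eexists; exact: C.
near=> n; apply: sumr_ge0 => i _.
by rewrite /zeta_tail polyexp1_ln ?ltr0n// mulr_ge0// powR_ge0.
Unshelve. all: by end_near. Qed.

Lemma is_derive_zeta_tail k n t : 0 < t ->
  is_derive t 1 (zeta_tail k n) (zeta_tail k.+1 n t / t).
Proof.
move=> t0.
have := is_derive_scale n.+2%:R^-1 (is_derive_polyexp_scale (theta_poly k) (ln n.+2%:R) t0).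
by move/is_derive_eq; apply; rewrite mulrA.
Qed.

Lemma symbol_zeta_ge1 m (j : nat) :
  symbol m [set t : R | 1 <= t] (fun t => t ^- j) (fun t => zeta (1 + t) - 1).
Proof.
suff : symbol m [set t : R | 1 <= t] (fun t => t ^- j)
    (fun t => limn (series (fun n => zeta_tail 0 n t))).
  by apply: eq_symbol => t t0; apply/cvg_lim => //; exact: cvg_zeta_tail.
have tl (c : R) : 0 < c -> cvgn (series (fun n => n.+2%:R `^ (- 1 - c) : R)).
  move=> c0; have [|//] := @series_norm_le _
    (fun n => n.+2%:R `^ (- 1 - c) : R) _ _ (cvg_series_zeta c0).
  move=> n; rewrite ger0_norm ?powR_ge0// -opprD !powRN lef_pV2 ?posrE ?powR_gt0 ?ltr0n//.
  by apply: ge0_ler_powR; rewrite ?nnegrE ?ler_nat//; lra.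
have lnn n : 0 < ln (n.+2%:R : R) by rewrite ln_gt0// ltr1n.
have E c t n : 0 <= c -> c <= t ->
    n.+2%:R^-1 * expR (- (t * ln n.+2%:R / 2)) <= n.+2%:R `^ (- 1 - c / 2) :> R.
  move=> c0 ct; rewrite powRD ?pnatr_eq0 ?implybT// powR_inv1// ler_wpM2l//.
  rewrite -expR_ln_powR ?ltr0n// ler_expR mulNr lerN2 mulrAC.
  by rewrite ler_wpM2r// ler_wpM2r ?(ltW (lnn _)).
apply: (@symbol_series _ _ _ zeta_tail) => [k n t t0|k a b a0|k].
- exact: is_derive_zeta_tail.
- have [C C0 H] := polyexp_bound (@theta_poly R k).
  have a20 : 0 < a / 2 by rewrite divr_gt0.
  have [c _] := series_lin2 C 0 (tl _ a20) (tl _ a20).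
  exists (fun n => C * n.+2%:R `^ (- 1 - a / 2) + 0 * n.+2%:R `^ (- 1 - a / 2)) => //.
  move=> n t /andP[at_ _]; rewrite mul0r addr0.
  rewrite /zeta_tail normrM ger0_norm//.
  have s0 : 0 <= t * ln n.+2%:R by rewrite mulr_ge0 ?(ltW (lnn _))//; lra.
  apply: (@le_trans _ _ (C * (n.+2%:R^-1 * expR (- (t * ln n.+2%:R / 2))))).
    by rewrite mulrCA ler_wpM2l// H.
  by rewrite ler_wpM2l//; apply: E; rewrite ?(ltW a0).
- have [C C0 H] := polyexp_bound_power (@theta_poly R k) j.
  have h0 : 0 < 1 / 2 :> R by [].
  have [c _] := series_lin2 (C * ln 2 ^- j) 0 (tl _ h0) (tl _ h0).
  exists (fun n => C * ln 2 ^- j * n.+2%:R `^ (- 1 - 1 / 2) +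
    0 * n.+2%:R `^ (- 1 - 1 / 2)) => //.
  move=> n t t0 /= t1; rewrite mul0r addr0.
  rewrite /zeta_tail normrM ger0_norm//.
  have s0 : 0 < t * ln n.+2%:R by rewrite mulr_gt0.
  apply: (@le_trans _ _ (n.+2%:R^-1 *
    (C * expR (- (t * ln n.+2%:R / 2)) * (t * ln n.+2%:R) ^- j))).
    by rewrite ler_wpM2l// H.
  have -> : n.+2%:R^-1 * (C * expR (- (t * ln n.+2%:R / 2)) * (t * ln n.+2%:R) ^- j) =
    C * (n.+2%:R^-1 * expR (- (t * ln n.+2%:R / 2))) * (ln n.+2%:R ^- j) * t ^- j.
    by rewrite exprMn invfM; ring.
  rewrite ler_wpM2r ?invr_ge0 ?exprn_ge0 ?(ltW t0)//.
  rewrite [X in _ <= X]mulrAC ler_pM ?mulr_ge0 ?expR_ge0 ?invr_ge0 ?exprn_ge0 ?(ltW (lnn _))//.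
    by rewrite ler_wpM2l// E.
  rewrite lef_pV2 ?posrE ?exprn_gt0//.
  rewrite lerXn2r ?nnegrE ?(ltW (lnn _))// ?(ltW (lnn 0%N))//.
  by rewrite ler_ln ?posrE ?ltr0n// ler_nat.
Qed.
End ZetaSymbol.

Section KernelProfile.
Context {R : realType}.
Implicit Types (t alpha : R).

Lemma r_le1E alpha t : 0 < t -> r_ alpha t =
  t `^ (- alpha) * ((1 + (t * zeta (1 + t) - 1)) `^ alpha - 1) + (-1).
Proof.
move=> t0; have -> : 1 + (t * zeta (1 + t) - 1) = t * zeta (1 + t) by ring.
have z0 : 0 <= zeta (1 + t) by have := zeta_sub1_ge0 t0; lra.
rewrite powRM ?(ltW t0)// mulrBr mulr1 mulrA -powRD; last by rewrite (gt_eqF t0) implybT.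
by rewrite addNr powRr0 mul1r /r_; ring.
Qed.

Lemma symbol_r_le1 alpha m : 1 < alpha ->
  symbol m [set t : R | t <= 1] (fun t => t `^ (1 - alpha)) (r_ alpha).
Proof.
move=> a1.
have w t : 0 < t -> [set t : R | t <= 1] t -> 0 <= id t <= 1.
  by move=> t0 /= ->; rewrite ltW.
have S1 := symbol_powR1DB1 alpha (@tzeta_sub1_ge0 R) w (symbol_zeta_le1 m).
have S2 := symbolM (symbol_powR m [set t : R | t <= 1] (- alpha)) S1.
apply: eq_symbol; first by move=> t t0; rewrite r_le1E//.
apply: symbolD.
- apply: (symbol_le (C := 1)) S2 => t t0 _.
  rewrite mulr_ge0 ?powR_ge0 ?(ltW t0)//= mul1r addrC powRD ?(gt_eqF t0) ?implybT//.
  by rewrite powRr1 ?(ltW t0).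
- apply: (symbol_le (C := 1)) (symbol_cst m _ (-1)) => t t0 /= t1; rewrite ler01/= mul1r.
  rewrite -[X in X <= _](powRr0 t); apply: ger_powR; rewrite ?t0//; lra.
Qed.

Lemma symbol_r_ge1 alpha m : 1 < alpha ->
  symbol m [set t : R | 1 <= t] (fun t => t `^ (- alpha)) (r_ alpha).
Proof.
move=> a1; set j := Num.bound alpha.
have ja : alpha <= j%:R.
  by apply/ltW; apply: archi_boundP; lra.
have w t : 0 < t -> [set t : R | 1 <= t] t -> 0 <= t ^- j <= 1.
  move=> t0 /= t1; rewrite invr_ge0 exprn_ge0 ?(ltW t0)//=.
  by rewrite invf_le1 ?exprn_gt0// exprn_ege1.
have S1 := symbol_powR1DB1 alpha (@zeta_sub1_ge0 R) w (symbol_zeta_ge1 m j).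
have : symbol m [set t : R | 1 <= t] (fun t => t `^ (- alpha))
    (fun t => ((1 + (zeta (1 + t) - 1)) `^ alpha - 1) + (-1) * t `^ (- alpha)).
  apply: symbolD; last by apply: symbolZ; exact: symbol_powR.
  apply: (symbol_le (C := 1)) S1 => t t0 /= t1.
  rewrite invr_ge0 exprn_ge0 ?(ltW t0)//= mul1r -powR_invn ?(ltW t0)//.
  by apply: ler_powR => //; rewrite lerN2.
apply: eq_symbol => t t0; rewrite /r_ mulN1r.
by have -> : 1 + (zeta (1 + t) - 1) = zeta (1 + t) by ring.
Qed.

Lemma derivable_derive1n_r alpha N t : 1 < alpha -> 0 < t ->
  derivable (derive1n N (r_ alpha)) t 1.
Proof.
move=> a1 t0.
have [H _] := symbol_derive1n (fun m => symbol_r_le1 m a1) N.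
exact: H.
Qed.

Lemma derive1n_r_bound alpha N : 1 < alpha -> exists2 C : R, 0 <= C &
  forall t, 0 < t -> `|derive1n N (r_ alpha) t| <= C * t `^ (- alpha - N%:R) /\
                     `|derive1n N (r_ alpha) t| <= C * t `^ (1 - alpha - N%:R).
Proof.
move=> a1.
have [_ /(_ 0%N) /symbol_bound [C1 H1]] := symbol_derive1n (fun m => symbol_r_le1 m a1) N.
have [_ /(_ 0%N) /symbol_bound [C2 H2]] := symbol_derive1n (fun m => symbol_r_ge1 m a1) N.
exists (`|C1| + `|C2|) => [|t t0]; first by rewrite addr_ge0.
have pD (a b : R) : t `^ (a + b) = t `^ a * t `^ b.
  by rewrite powRD// (gt_eqF t0) implybT.
have W w C : 0 <= w -> `|derive1n N (r_ alpha) t| <= C * w -> `|C| <= `|C1| + `|C2| ->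
    `|derive1n N (r_ alpha) t| <= (`|C1| + `|C2|) * w.
  by move=> w0 H HC; rewrite (le_trans H)// ler_wpM2r// (le_trans _ HC)// ler_norm.
have c1 : `|C1| <= `|C1| + `|C2| by rewrite lerDl.
have c2 : `|C2| <= `|C1| + `|C2| by rewrite lerDr.
have [t1|/ltW t1] := leP t 1.
- have B := W _ _ _ (H1 t t0 t1) c1; rewrite -pD in B.
  have {}B := B (powR_ge0 _ _); split=> //; apply: (le_trans B).
  rewrite ler_wpM2l ?addr_ge0//; apply: ger_powR; rewrite ?t0//; lra.
- have B := W _ _ _ (H2 t t0 t1) c2; rewrite -pD in B.
  have {}B := B (powR_ge0 _ _); split=> //; apply: (le_trans B).
  rewrite ler_wpM2l ?addr_ge0//; apply: ler_powR => //; lra.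
Qed.
End KernelProfile.

(** * The Schur test on the half-line *)

Section HalfLine.
Context {R : realType}.
Notation mu := (@lebesgue_measure R).
Notation Rp := (@Rplus R).
Implicit Types (f g v : R -> R) (x y m : R).

Lemma RplusE x : Rp x = (0 < x) :> Prop.
Proof. by rewrite /Rplus/= in_itv/= andbT. Qed.

Lemma measurable_Rplus : measurable (Rp : set (measurableTypeR R)).
Proof. exact: measurable_itv. Qed.

Lemma open_Rplus : open Rp.
Proof. exact: interval_open. Qed.

Lemma continuous_measurable_Rplus f :
  (forall y, 0 < y -> {for y, continuous f}) -> measurable_fun Rp f.
Proof.
move=> cf; apply: open_continuous_measurable_fun; first exact: open_Rplus.
by move=> y; rewrite inE RplusE => /cf.
Qed.

Lemma derivable_continuous f x : derivable f x 1 -> {for x, continuous f}.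
Proof. by move=> df; apply: differentiable_continuous; apply/derivable1_diffP. Qed.

Lemma ge0_le_integral_Rplus f g : measurable_fun Rp f -> measurable_fun Rp g ->
  (forall x, 0 < x -> 0 <= f x) -> (forall x, 0 < x -> f x <= g x) ->
  (\int[mu]_(x in Rp) (f x)%:E <= \int[mu]_(x in Rp) (g x)%:E)%E.
Proof.
move=> mf mg f0 fg; apply: ge0_le_integral => //.
- exact: measurable_Rplus.
- by move=> x; rewrite RplusE lee_fin => /f0.
- exact/measurable_EFinP.
- exact/measurable_EFinP.
- by move=> x; rewrite RplusE lee_fin => /fg.
Qed.

Lemma ge0_integralZl_Rplus f c : measurable_fun Rp f ->
  (forall x, 0 < x -> 0 <= f x) -> 0 <= c ->
  (\int[mu]_(x in Rp) (c * f x)%:E = c%:E * \int[mu]_(x in Rp) (f x)%:E)%E.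
Proof.
move=> mf f0 c0; under eq_integral do rewrite EFinM.
apply: ge0_integralZl_EFin => //; first exact: measurable_Rplus.
- by move=> x; rewrite RplusE lee_fin => /f0.
- exact/measurable_EFinP.
Qed.

Lemma integral_derivative_le1 f F :
  (forall y, 0 < y -> is_derive y 1 F (f y)) ->
  (forall y, 0 < y -> {for y, continuous f}) ->
  (forall y, 0 < y -> 0 <= f y) ->
  (forall y, 0 < y -> 0 <= F y <= 1) ->
  (\int[mu]_(y in Rp) (f y)%:E <= 1)%E.
Proof.
move=> dF cf f0 F01.
pose E n : set R := `[n.+2%:R^-1, n.+2%:R]%classic.
have i0 n : 0 < n.+2%:R^-1 :> R by rewrite invr_gt0 ltr0n.
have EU : \bigcup_n E n = Rp.
  apply/seteqP; split=> x.
    by move=> [n _]; rewrite /E/= in_itv/= RplusE => /andP[+ _]; exact: lt_le_trans.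
  rewrite RplusE => x0; exists (Num.bound x + Num.bound x^-1)%N => //.
  have b1 : x <= (Num.bound x + Num.bound x^-1)%N.+2%:R.
    apply: (@le_trans _ _ (Num.bound x)%:R); first by rewrite ltW// archi_boundP// ltW.
    by rewrite ler_nat -addnS -addnS leq_addr.
  have b2 : x^-1 <= (Num.bound x + Num.bound x^-1)%N.+2%:R.
    apply: (@le_trans _ _ (Num.bound x^-1)%:R).
      by rewrite ltW// archi_boundP// invr_ge0 ltW.
    by rewrite ler_nat -addSn -addSn leq_addl.
  rewrite /E/= in_itv/= b1 andbT -[X in _ <= X]invrK lef_pV2 ?posrE ?invr_gt0 ?ltr0n//.
have mf : measurable_fun Rp f by exact: continuous_measurable_Rplus.
have ER n : E n `<=` Rp.
  by move=> x; rewrite /E/= in_itv/= RplusE => /andP[+ _]; exact: lt_le_trans.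
have H : (\int[mu]_(x in E i) (f x)%:E)%E @[i --> \oo] -->
    (\int[mu]_(x in \bigcup_i E i) (f x)%:E)%E.
  apply: ge0_nondecreasing_set_cvg_integral.
  - apply/nondecreasing_seqP => n; rewrite subsetEset /E => x/=.
    rewrite !in_itv/= => /andP[x1 x2]; apply/andP; split.
      by rewrite (le_trans _ x1)// lef_pV2 ?posrE ?ltr0n// ler_nat.
    by rewrite (le_trans x2)// ler_nat.
  - by move=> n; exact: measurable_itv.
  - move=> n; apply/measurable_EFinP; apply: measurable_funS mf => //.
    exact: measurable_Rplus.
  - by move=> n x /ER; rewrite RplusE lee_fin => /f0.
rewrite -EU -(cvg_lim _ H)//; apply: lime_le; first by apply/cvg_ex; eexists; exact: H.
near=> n.
have ab : n.+2%:R^-1 < n.+2%:R :> R.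
  apply: (@lt_trans _ _ 1); last by rewrite ltr1n.
  by rewrite invf_lt1 ?ltr0n// ltr1n.
rewrite (@continuous_FTC2 _ f F)//.
- have /andP[_ h1] := F01 n.+2%:R (ltr0n _ _).
  have /andP[h2 _] := F01 _ (i0 n).
  by rewrite -EFinB lee_fin; lra.
- apply: continuous_in_subspaceT => y /set_mem/=; rewrite in_itv/= => /andP[y0 _].
  by apply: cf; apply: lt_le_trans y0.
- split.
  + move=> y; rewrite in_itv/= => /andP[y0 _].
    by have [] := dF y (lt_trans (i0 n) y0).
  + by apply: cvg_at_right_filter; apply: derivable_continuous; have [] := dF _ (i0 n).
  + apply: cvg_at_left_filter; apply: derivable_continuous.
    by have [] := dF n.+2%:R (ltr0n _ _).
- move=> y; rewrite in_itv/= => /andP[y0 _]; rewrite derive1E.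
  by have [_ ->] := dF y (lt_trans (i0 n) y0).
Unshelve. all: by end_near. Qed.

(* [y^m / (x^m + y^m)] is a primitive of [m x^m] times the integrand. *)
Lemma integral_powR_ratio m x : 0 < m -> 0 < x ->
  (\int[mu]_(y in Rp) (y `^ (m - 1) * (x `^ m + y `^ m) `^ (- 2%:R))%:E <=
   (m^-1 * x `^ (- m))%:E)%E.
Proof.
move=> m0 x0.
have xm0 : 0 < x `^ m by exact: powR_gt0.
have s0 y : 0 < y -> 0 < x `^ m + y `^ m.
  by move=> y0; rewrite addr_gt0// powR_gt0.
pose g y := y `^ (m - 1) * (x `^ m + y `^ m) `^ (- 2%:R).
have ds y : 0 < y -> is_derive y 1 (fun z => x `^ m + z `^ m) (m * y `^ (m - 1)).
  move=> y0; have := is_derive_add (is_derive_const (x `^ m) y) (is_derive1_powR m y0).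
  by move/is_derive_eq; apply; rewrite add0r.
have dpow b y : 0 < y -> is_derive y 1 (fun z => (x `^ m + z `^ m) `^ b)
    (b * (x `^ m + y `^ m) `^ (b - 1) * (m * y `^ (m - 1))).
  by move=> y0; exact: is_derive_comp (ds y y0) (is_derive1_powR b (s0 y y0)).
have dF y : 0 < y -> is_derive y 1 (fun z => z `^ m * (x `^ m + z `^ m) `^ (- 1))
    (m * x `^ m * g y).
  move=> y0; have := is_derive_mul (is_derive1_powR m y0) (dpow (- 1) y y0).
  move/is_derive_eq; apply; rewrite /g.
  have -> : -1 - 1 = - 2%:R :> R by rewrite -opprD.
  rewrite powR_inv1 ?powR_invn ?(ltW (s0 _ y0))//.
  have -> : m * x `^ m * (y `^ (m - 1) * (x `^ m + y `^ m) ^- 2) =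
     m * y `^ (m - 1) * x `^ m / (x `^ m + y `^ m) ^+ 2 by ring.
  have := s0 y y0; move: (y `^ (m - 1)) (y `^ m) (x `^ m) => p q r r0.
  by field; rewrite gt_eqF.
have dg y : 0 < y -> derivable g y 1.
  move=> y0; have [] := is_derive_mul (is_derive1_powR (m - 1) y0) (dpow (- 2%:R) y y0).
  by [].
have g0 y : 0 <= g y by rewrite mulr_ge0 ?powR_ge0.
have mg : measurable_fun Rp g.
  by apply: continuous_measurable_Rplus => y y0; apply: derivable_continuous; exact: dg.
have H : (\int[mu]_(y in Rp) (m * x `^ m * g y)%:E <= 1)%E.
  apply: (integral_derivative_le1 dF).
  - move=> y y0; apply: derivable_continuous.
    have [D _] := is_derive_scale (m * x `^ m) (derivableP (dg y y0)).
    exact: D.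
  - by move=> y y0; rewrite mulr_ge0// mulr_ge0 ?powR_ge0 ?ltW.
  - move=> y y0; rewrite mulr_ge0 ?powR_ge0//= powR_inv1 ?(ltW (s0 _ y0))//.
    by rewrite ler_pdivrMr ?s0// mul1r lerDr ltW.
have E y : g y = (m^-1 * x `^ (- m)) * (m * x `^ m * g y).
  by rewrite powRN; field; rewrite !gt_eqF.
under eq_integral do rewrite -/(g _) E.
have c0 : 0 <= m^-1 * x `^ (- m) by rewrite mulr_ge0 ?powR_ge0// invr_ge0 ltW.
rewrite ge0_integralZl_Rplus//.
- by rewrite -[leRHS]mule1 lee_wpmul2l.
- apply: measurable_funM => //; exact: measurable_cst.
- by move=> y y0; rewrite mulr_ge0// mulr_ge0 ?powR_ge0 ?ltW.
Qed.
End HalfLine.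

Section Schur.
Context {R : realType}.
Notation mu := (@lebesgue_measure R).
Notation Rp := (@Rplus R).
Implicit Types (f g v S : R -> R) (x y m : R).

Definition schurK m x y : R :=
  x `^ (m - 2^-1) * y `^ (m - 2^-1) * (x `^ m + y `^ m) `^ (- 2%:R).

Lemma schurK_ge0 m x y : 0 <= schurK m x y.
Proof. by rewrite !mulr_ge0 ?powR_ge0. Qed.

Lemma schurKC m x y : schurK m x y = schurK m y x.
Proof. by rewrite /schurK (addrC (x `^ m)) (mulrC (x `^ _)). Qed.

Lemma measurable_powR_fst a : measurable_fun [set: R * R] (fun z : R * R => z.1 `^ a).
Proof. exact: (measurableT_comp (measurable_powR a) measurable_fst). Qed.

Lemma measurable_powR_snd a : measurable_fun [set: R * R] (fun z : R * R => z.2 `^ a).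
Proof. exact: (measurableT_comp (measurable_powR a) measurable_snd). Qed.

Lemma measurable_schurK2 m : measurable_fun [set: R * R] (fun z : R * R => schurK m z.1 z.2).
Proof.
apply: measurable_funM.
  by apply: measurable_funM; [exact: measurable_powR_fst|exact: measurable_powR_snd].
apply: (measurableT_comp (measurable_powR (- 2%:R))).
by apply: measurable_funD; [exact: measurable_powR_fst|exact: measurable_powR_snd].
Qed.

Lemma measurable_schurK m x : measurable_fun [set: R] (schurK m x).
Proof.
apply: measurable_funM.
  by apply: measurable_funM; [exact: measurable_cst|exact: measurable_powR].
apply: (measurableT_comp (measurable_powR (- 2%:R))).
by apply: measurable_funD; [exact: measurable_cst|exact: measurable_powR].
Qed.

Lemma integral_schurK m x : 0 < m -> 0 < x ->
  (\int[mu]_(y in Rp) (schurK m x y * y `^ (- 2^-1))%:E <= (m^-1 * x `^ (- 2^-1))%:E)%E.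
Proof.
move=> m0 x0.
have E y : y \in Rp -> (schurK m x y * y `^ (- 2^-1))%:E =
    (x `^ (m - 2^-1) * (y `^ (m - 1) * (x `^ m + y `^ m) `^ (- 2%:R)))%:E.
  rewrite inE RplusE => y0; congr EFin.
  have -> : m - 1 = (m - 2^-1) + (- 2^-1) by field.
  rewrite (@powRD _ y (m - 2^-1)) ?(gt_eqF y0) ?implybT//.
  by rewrite /schurK; ring.
under eq_integral => y yR do rewrite (E y yR).
rewrite ge0_integralZl_Rplus ?powR_ge0//; last 2 first.
- apply: measurable_funTS; apply: measurable_funM; first exact: measurable_powR.
  apply: (measurableT_comp (measurable_powR (- 2%:R))).
  by apply: measurable_funD; [exact: measurable_cst|exact: measurable_powR].
- by move=> y _; rewrite mulr_ge0 ?powR_ge0.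
have -> : m^-1 * x `^ (- 2^-1) = x `^ (m - 2^-1) * (m^-1 * x `^ (- m)).
  rewrite mulrCA -powRD ?(gt_eqF x0) ?implybT//.
  by congr (_ * powR _ _); ring.
rewrite [leRHS]EFinM lee_wpmul2l ?lee_fin ?powR_ge0//.
exact: integral_powR_ratio.
Qed.

(* The Schur test with the weights [x^-1/2], [y^-1/2]. *)
Section SchurTest.
Variables (m : R) (v : R -> R).
Hypotheses (m0 : 0 < m) (mv : measurable_fun Rp v).

Let H (z : R * R) : R := z.1 `^ (- 2^-1) * schurK m z.1 z.2 * z.2 `^ (2^-1) *
  ((v \_ Rp) z.2) ^+ 2 * \1_Rp z.1.

Let F := fubini_F mu (EFin \o H).

Let H_ge0 z : 0 <= H z.
Proof.
apply: mulr_ge0; last by rewrite indicE ler0n.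
by apply: mulr_ge0; rewrite ?sqr_ge0// !mulr_ge0 ?powR_ge0 ?schurK_ge0.
Qed.

Let term_ge0 x y : 0 <= x `^ (- 2^-1) * (schurK m x y * y `^ (2^-1) * v y ^+ 2).
Proof.
apply: mulr_ge0; first exact: powR_ge0.
by apply: mulr_ge0; rewrite ?sqr_ge0// mulr_ge0 ?powR_ge0 ?schurK_ge0.
Qed.

Let mH : measurable_fun [set: R * R] (EFin \o H).
Proof.
have mvr : measurable_fun [set: R] (v \_ Rp).
  by apply: (measurable_restrictT _ measurable_Rplus).1.
apply/measurable_EFinP; apply: measurable_funM; last first.
  have mi : measurable_fun [set: R] (\1_Rp : R -> R).
    by apply: measurable_indic; exact: measurable_Rplus.
  exact: (measurableT_comp mi measurable_fst).
apply: measurable_funM; last first.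
  by apply: measurable_funX; exact: (measurableT_comp mvr measurable_snd).
apply: measurable_funM; last exact: measurable_powR_snd.
by apply: measurable_funM; [exact: measurable_powR_fst|exact: measurable_schurK2].
Qed.

Let F_ge0 x : (0 <= F x)%E.
Proof. by apply: integral_ge0 => y _; rewrite lee_fin. Qed.

Let FE x : 0 < x -> F x =
  (\int[mu]_(y in Rp) (x `^ (- 2^-1) * (schurK m x y * y `^ (2^-1) * v y ^+ 2))%:E)%E.
Proof.
move=> x0; have xR : x \in Rp by rewrite inE RplusE.
rewrite integral_mkcond; apply: eq_integral => y _ /=.
rewrite /H /= !patchE indicE xR mulr1.
by case: ifPn => _; [congr EFin; ring|rewrite expr0n mulr0].
Qed.

Let mvabs : measurable_fun Rp (fun y => `|v y|).
Proof. exact: (measurableT_comp (@normr_measurable R setT) mv). Qed.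

Lemma schur_pointwise (C x g : R) : 0 <= C -> 0 < x -> 0 <= g ->
  (g%:E <= C%:E * \int[mu]_(y in Rp) (schurK m x y * `|v y|)%:E)%E ->
  ((g ^+ 2)%:E <= (C ^+ 2 / m)%:E * F x)%E.
Proof.
move=> C0 x0 g0 gC.
have Cm0 : 0 <= C ^+ 2 / m by rewrite divr_ge0 ?sqr_ge0// ltW.
move: g0; rewrite le_eqVlt => /predU1P[<-|g0].
  by rewrite expr0n/= mule_ge0// lee_fin.
have {}C0 : 0 < C.
  rewrite lt_neqAle C0 andbT; apply/negP => /eqP C00.
  by move: gC; rewrite -C00 mul0e lee_fin leNgt g0.
have C2m : 0 < C ^+ 2 / m by rewrite divr_gt0 ?exprn_gt0.
set l := C * x `^ (- 2^-1) / (m * g).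
have xh0 : 0 < x `^ (- 2^-1) by exact: powR_gt0.
have l0 : 0 < l by rewrite /l divr_gt0 ?mulr_gt0.
have l2 : 0 < 2 * l by lra.
have c1 : 0 <= l / (2 * x `^ (- 2^-1)).
  have x2 : 0 < 2 * x `^ (- 2^-1) by lra.
  exact/ltW/divr_gt0.
have c2 : 0 <= (2 * l)^-1 by rewrite invr_ge0 ltW.
have mZ c (f : R -> R) : measurable_fun Rp f -> measurable_fun Rp (fun y => c * f y).
  by move=> mf; exact: (measurable_funM (measurable_cst c) mf).
have mK a : measurable_fun Rp (fun y => schurK m x y * y `^ a).
  apply: measurable_funTS; apply: measurable_funM; first exact: measurable_schurK.
  exact: measurable_powR.
have mKv : measurable_fun Rp (fun y => x `^ (- 2^-1) * (schurK m x y * y `^ (2^-1) * v y ^+ 2)).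
  apply: measurable_funM; first exact: measurable_cst.
  by apply: measurable_funM => //; apply: measurable_funX.
have G : (\int[mu]_(y in Rp) (schurK m x y * `|v y|)%:E <=
     (l / (2 * x `^ (- 2^-1)))%:E * F x + ((2 * l)^-1)%:E * (m^-1 * x `^ (- 2^-1))%:E)%E.
  apply: (@le_trans _ _ (\int[mu]_(y in Rp)
    ((l / (2 * x `^ (- 2^-1)) * (x `^ (- 2^-1) * (schurK m x y * y `^ (2^-1) * v y ^+ 2)))%:E
     + ((2 * l)^-1 * (schurK m x y * y `^ (- 2^-1)))%:E)))%E.
    apply: ge0_le_integral => //.
    - exact: measurable_Rplus.
    - by move=> y _; rewrite lee_fin mulr_ge0 ?schurK_ge0.
    - apply/measurable_EFinP; apply: measurable_funM => //.
      by apply: measurable_funTS; exact: measurable_schurK.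
    - apply: emeasurable_funD; apply/measurable_EFinP; [exact: (mZ _ _ mKv)|exact: (mZ _ _ (mK _))].
    - move=> y; rewrite RplusE => y0; rewrite -EFinD lee_fin.
      (* AM-GM: [|v| <= l y^(1/2) v^2 / 2 + y^(-1/2) / (2 l)]; the choice of [l] above
         balances the two integrals. *)
      have -> : l / (2 * x `^ (- 2^-1)) * (x `^ (- 2^-1) * (schurK m x y * y `^ 2^-1 * v y ^+ 2)) +
        (2 * l)^-1 * (schurK m x y * y `^ (- 2^-1)) =
        schurK m x y * (l / 2 * y `^ 2^-1 * v y ^+ 2 + y `^ (- 2^-1) / (2 * l)).
        by field; rewrite !gt_eqF.
      rewrite ler_wpM2l ?schurK_ge0// powRN.
      have p0 : 0 < y `^ 2^-1 by exact: powR_gt0.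
      move: p0; move: (y `^ 2^-1) => p p0.
      rewrite -subr_ge0 -[v y ^+ 2]real_normK ?num_real//.
      have -> : l / 2 * p * `|v y| ^+ 2 + p^-1 / (2 * l) - `|v y| =
        (l * p * `|v y| - 1) ^+ 2 / (2 * l * p) by field; rewrite !gt_eqF.
      by apply: divr_ge0; [exact: sqr_ge0|exact/ltW/mulr_gt0].
  rewrite ge0_integralD; last 5 first.
  - exact: measurable_Rplus.
  - by move=> y _; rewrite lee_fin mulr_ge0// divr_ge0 ?mulr_ge0 ?(ltW xh0) ?(ltW l0).
  - by apply/measurable_EFinP; exact: (mZ _ _ mKv).
  - by move=> y _; rewrite lee_fin mulr_ge0// mulr_ge0 ?powR_ge0 ?schurK_ge0.
  - by apply/measurable_EFinP; exact: (mZ _ _ (mK _)).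
  apply: leeD.
    by rewrite FE// ge0_integralZl_Rplus.
  rewrite ge0_integralZl_Rplus//.
  - by rewrite lee_wpmul2l ?lee_fin//; exact: integral_schurK.
  - by move=> y _; rewrite mulr_ge0 ?powR_ge0 ?schurK_ge0.
have {}gC := le_trans gC (lee_wpmul2l (ltW C0 : (0 <= C%:E)%E) G).
move: gC (F_ge0 x); case: (F x) => [r||] //; last first.
  by move=> _ _; rewrite gt0_muley ?lte_fin// leey.
rewrite -(EFinM (l / _) r) -(EFinM (2 * l)^-1) -EFinD -(EFinM C) -EFinM !lee_fin => gC r0.
have E1 : C * (l / (2 * x `^ (- 2^-1)) * r + (2 * l)^-1 * (m^-1 * x `^ (- 2^-1))) =
   C ^+ 2 / m * r / (2 * g) + g / 2.
  by rewrite /l; field; rewrite !gt_eqF.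
rewrite E1 in gC.
have : g / 2 <= C ^+ 2 / m * r / (2 * g) by lra.
rewrite ler_pdivlMr ?mulr_gt0//.
by have -> : g / 2 * (2 * g) = g ^+ 2 by field.
Qed.

Lemma schur_test (C : R) S : 0 <= C -> measurable_fun Rp S ->
  (forall x, 0 < x ->
    (`|S x|%:E <= C%:E * \int[mu]_(y in Rp) (schurK m x y * `|v y|)%:E)%E) ->
  (\int[mu]_(x in Rp) (S x ^+ 2)%:E <=
    (C ^+ 2 / m ^+ 2)%:E * \int[mu]_(x in Rp) (v x ^+ 2)%:E)%E.
Proof.
move=> C0 mS HS.
have Cm0 : 0 <= C ^+ 2 / m by rewrite divr_ge0 ?sqr_ge0// ltW.
have mF : measurable_fun [set: R] F.
  by apply: measurable_fun_fubini_tonelli_F => // z; rewrite lee_fin.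
have minv0 : 0 <= m^-1 by rewrite invr_ge0 ltW.
apply: (@le_trans _ _ (\int[mu]_(x in Rp) ((C ^+ 2 / m)%:E * F x))%E).
  apply: ge0_le_integral => //.
  - exact: measurable_Rplus.
  - by move=> x _; rewrite lee_fin sqr_ge0.
  - by apply/measurable_EFinP; apply: measurable_funX.
  - by apply: measurable_funeM; exact: measurable_funTS.
  - move=> x; rewrite RplusE => x0; rewrite -[S x ^+ 2]real_normK ?num_real//.
    by apply: schur_pointwise => //; exact: HS.
rewrite ge0_integralZl_EFin//; last 2 first.
  exact: measurable_Rplus.
  exact: measurable_funTS.
have -> : C ^+ 2 / m ^+ 2 = C ^+ 2 / m * m^-1 by rewrite -mulrA -invfM expr2.
rewrite [in leRHS]EFinM -muleA lee_wpmul2l//.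
apply: (@le_trans _ _ (\int[mu]_x F x)%E).
  apply: ge0_subset_integral => //; exact: measurable_Rplus.
rewrite /F /fubini_F (@fubini_tonelli _ _ _ _ R mu mu (EFin \o H))//.
have mvr : measurable_fun [set: R] (v \_ Rp).
  by apply: (measurable_restrictT _ measurable_Rplus).1.
rewrite [in leRHS]integral_mkcond -ge0_integralZl_EFin//; last 2 first.
- by move=> y _; apply: erestrict_ge0 => z _; rewrite lee_fin sqr_ge0.
- apply: (measurable_restrictT _ measurable_Rplus).1.
  by apply/measurable_EFinP; apply: measurable_funX.
apply: ge0_le_integral => //.
- by move=> y _; apply: integral_ge0 => x _; rewrite lee_fin.
- by apply: measurable_fun_fubini_tonelli_G => // z; rewrite lee_fin.
- apply: measurable_funeM; apply: (measurable_restrictT _ measurable_Rplus).1.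
  by apply/measurable_EFinP; apply: measurable_funX.
move=> y _; rewrite patchE; case: ifPn => [|yN]; last first.
  rewrite mule0 integral0_eq// => x _ /=.
  by rewrite /H/= patchE (negbTE yN) expr0n mulr0 mul0r.
move=> yR; have y0 : 0 < y by move: yR; rewrite inE RplusE.
have E x : (EFin \o H) (x, y) =
   ((fun x => (y `^ 2^-1 * v y ^+ 2 * (schurK m y x * x `^ (- 2^-1)))%:E) \_ Rp) x.
  rewrite /H/= !patchE yR indicE; case: ifPn => _; last by rewrite mulr0.
  by rewrite (schurKC m x y) mulr1; congr EFin; ring.
under eq_integral do rewrite E.
rewrite -integral_mkcond ge0_integralZl_Rplus; last 3 first.
- apply: measurable_funTS; apply: measurable_funM; first exact: measurable_schurK.
  exact: measurable_powR.
- by move=> x _; rewrite mulr_ge0 ?powR_ge0 ?schurK_ge0.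
- by rewrite mulr_ge0 ?powR_ge0 ?sqr_ge0.
apply: (@le_trans _ _ ((y `^ 2^-1 * v y ^+ 2)%:E * (m^-1 * y `^ (- 2^-1))%:E)%E).
  apply: lee_wpmul2l; last exact: integral_schurK.
  by rewrite lee_fin mulr_ge0 ?powR_ge0 ?sqr_ge0.
rewrite -!EFinM lee_fin le_eqVlt; apply/orP; left; apply/eqP.
by rewrite powRN; field; rewrite !gt_eqF// powR_gt0.
Qed.
End SchurTest.
End Schur.

(** * The operator and its derivatives *)

Section RealOperator.
Context {R : realType}.
Notation mu := (@lebesgue_measure R).
Notation Rp := (@Rplus R).
Implicit Types (f g v : R -> R) (x y m : R).

Lemma powR_add_le m x y : 0 <= m -> 0 < x -> 0 < y ->
  (x + y) `^ (- (2 * m)) <= 4 * (x `^ m + y `^ m) `^ (- 2%:R).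
Proof.
move=> m0 x0 y0; have xy0 : 0 < x + y by rewrite addr_gt0.
have le_m z : 0 < z -> z <= x + y -> z `^ m <= (x + y) `^ m.
  by move=> z0 zxy; apply: ge0_ler_powR; rewrite ?nnegrE ?(ltW z0) ?(ltW xy0).
have h1 : x `^ m <= (x + y) `^ m by apply: le_m => //; rewrite lerDl ltW.
have h2 : y `^ m <= (x + y) `^ m by apply: le_m => //; rewrite lerDr ltW.
have s0 : 0 < x `^ m + y `^ m by rewrite addr_gt0// powR_gt0.
have p0 : 0 < (x + y) `^ m by exact: powR_gt0.
have -> : - (2 * m) = m * (- 2%:R) by ring.
rewrite powRrM !powR_invn ?(ltW s0) ?(ltW p0)//.
rewrite ler_pdivlMr ?exprn_gt0// mulrC ler_pdivrMr ?exprn_gt0//.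
have -> : 4 * ((x + y) `^ m) ^+ 2 = (2 * (x + y) `^ m) ^+ 2 by ring.
rewrite ler_pXn2r ?nnegrE//; [lra|exact: ltW|by rewrite mulr_ge0 ?(ltW p0)].
Qed.

Section Operator.
Variables (alpha : R) (a1 : 1 < alpha).

(* [P_rho^N R_alpha v = x^rho * profileJ N v]. *)
Definition profileK N v x y : R :=
  y `^ rho_ alpha * derive1n N (r_ alpha) (x + y) * v y.

Definition profileJ N v x : R := (\int[mu]_(y in Rp) profileK N v x y)%R.

Variables (v : R -> R) (mv : measurable_fun Rp v).

Lemma measurable_profileK N x : 0 < x -> measurable_fun Rp (profileK N v x).
Proof.
move=> x0; apply: measurable_funM => //; apply: measurable_funM.
  by apply: measurable_funTS; exact: measurable_powR.
apply: continuous_measurable_Rplus => y y0.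
have D := derivable_derive1n_r (N := N) a1 (addr_gt0 x0 y0).
have := is_derive_comp (is_derive_add (is_derive_const x y) (is_derive_id y (1 : R)))
  (derivableP D).
by move=> [+ _]; exact: derivable_continuous.
Qed.

Hypothesis v2 : (\int[mu]_(y in Rp) (v y ^+ 2)%:E < +oo)%E.

Lemma profileK_dominated N (a : R) : 0 < a -> exists G : R -> R,
  [/\ forall y, 0 <= G y, mu.-integrable Rp (EFin \o G) &
      forall x y, a <= x -> 0 < y -> `|profileK N v x y| <= G y].
Proof.
move=> a0; have [C C0 HC] := derive1n_r_bound N a1.
pose g y := y `^ (alpha - 1) * (a `^ alpha + y `^ alpha) `^ (- 2%:R).
have g0 y : 0 <= g y by rewrite mulr_ge0 ?powR_ge0.
have mg : measurable_fun Rp g.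
  apply: measurable_funTS; apply: measurable_funM; first exact: measurable_powR.
  apply: (measurableT_comp (measurable_powR (- 2%:R))).
  by apply: measurable_funD; [exact: measurable_cst|exact: measurable_powR].
have alpha0 : 0 < alpha by exact: lt_trans a1.
have ig : mu.-integrable Rp (EFin \o g).
  apply/integrableP; split; first exact/measurable_EFinP.
  under eq_integral do rewrite /= ger0_norm//.
  by apply: le_lt_trans (integral_powR_ratio alpha0 a0) _; rewrite ltry.
have iv : mu.-integrable Rp (EFin \o (fun y => v y ^+ 2)).
  apply/integrableP; split; first by apply/measurable_EFinP; exact: measurable_funX.
  by under eq_integral do rewrite /= ger0_norm ?sqr_ge0//.
pose c := C * a `^ (- N%:R).
have c0 : 0 <= c by rewrite mulr_ge0 ?powR_ge0.
exists (fun y => c * (4 * g y) + c * v y ^+ 2); split.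
- move=> y; apply: addr_ge0; apply: mulr_ge0; rewrite ?sqr_ge0//.
  exact: mulr_ge0.
- have -> : EFin \o (fun y => c * (4 * g y) + c * v y ^+ 2) =
    ((fun y => (c * 4)%:E * (g y)%:E) \+ (fun y => c%:E * ((v y ^+ 2)%R)%:E))%E.
    by apply/funext => y /=; rewrite EFinD mulrA -!EFinM.
  apply: (integrableD measurable_Rplus);
    by apply: integrableZl => //; exact: measurable_Rplus.
- move=> x y ax y0; have x0 : 0 < x by exact: lt_le_trans ax.
  have xy0 : 0 < x + y by rewrite addr_gt0.
  have [H _] := HC _ xy0.
  rewrite /profileK !normrM ger0_norm ?powR_ge0//.
  have pD (s t : R) : (x + y) `^ (s + t) = (x + y) `^ s * (x + y) `^ t.
    by rewrite powRD// (gt_eqF xy0) implybT.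
  rewrite pD in H.
  have mono s : s <= 0 -> (x + y) `^ s <= (a + y) `^ s.
    move=> s0; rewrite -[s]opprK !(powRN _ (- s)).
    have ay0 : 0 < a + y by rewrite addr_gt0.
    rewrite lef_pV2 ?posrE ?powR_gt0//; apply: ge0_ler_powR; rewrite ?nnegrE; lra.
  have mono' : (x + y) `^ (- N%:R) <= a `^ (- N%:R).
    rewrite !powRN lef_pV2 ?posrE ?powR_gt0//; apply: ge0_ler_powR; rewrite ?nnegrE//; lra.
  have {}H : `|derive1n N (r_ alpha) (x + y)| <= c * (a + y) `^ (- alpha).
    apply: (le_trans H); rewrite /c -mulrA ler_wpM2l// mulrC.
    by apply: ler_pM; rewrite ?powR_ge0// mono// oppr_le0 ltW.
  set p := y `^ rho_ alpha; set q := (a + y) `^ (- alpha).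
  apply: (@le_trans _ _ (c * ((p * q) * `|v y|))).
    have -> : c * (p * q * `|v y|) = p * (c * q) * `|v y| by ring.
    by rewrite ler_wpM2r// ler_wpM2l ?powR_ge0.
  rewrite -mulrDr ler_wpM2l//.
  have E : (p * q) ^+ 2 <= 4 * g y.
    have -> : (p * q) ^+ 2 = y `^ (alpha - 1) * (a + y) `^ (- (2 * alpha)).
      rewrite exprMn /p /q -!powR_mulrn ?powR_ge0// -!powRrM.
      by congr (powR _ _ * powR _ _); rewrite /rho_; field.
    rewrite /g mulrCA ler_wpM2l ?powR_ge0//; apply: powR_add_le => //; exact: ltW.
  have := sqr_ge0 (p * q - `|v y|); rewrite sqrrB real_normK ?num_real// => S.
  have p2 := sqr_ge0 (p * q); have v0 := sqr_ge0 (v y).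
  by rewrite mulr2n in S; lra.
Qed.

Lemma integrable_profileK N x : 0 < x -> mu.-integrable Rp (EFin \o profileK N v x).
Proof.
move=> x0; have [G [G0 iG HG]] := profileK_dominated N x0.
apply: le_integrable iG; first exact: measurable_Rplus.
  by apply/measurable_EFinP; exact: measurable_profileK.
move=> y; rewrite RplusE => y0 /=; rewrite lee_fin (ger0_norm (G0 y)).
exact: HG.
Qed.

Lemma is_derive_profileJ N x : 0 < x ->
  is_derive x 1 (profileJ N v) (profileJ N.+1 v x).
Proof.
move=> x0; have a0 : 0 < x / 2 by rewrite divr_gt0.
have [G [G0 iG HG]] := profileK_dominated N.+1 a0.
have Ix : `]x / 2, x + 1[%classic x by rewrite /= in_itv/=; apply/andP; split; lra.
have dK t y : `]x / 2, x + 1[%classic t -> Rp y ->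
    is_derive t 1 (fun t => profileK N v t y) (profileK N.+1 v t y).
  rewrite /= in_itv/= RplusE => /andP[t1 _] y0.
  have ty0 : 0 < t + y by lra.
  have D := derivable_derive1n_r (N := N) a1 ty0.
  have D1 := is_derive_comp (is_derive_add (is_derive_id t (1 : R)) (is_derive_const y t))
    (derivableP D).
  have := is_derive_mul (is_derive_scale (y `^ rho_ alpha) D1) (is_derive_const (v y) t).
  move/is_derive_eq; apply; rewrite /profileK derive1nS derive1E.
  by ring.
have iK t : `]x / 2, x + 1[%classic t -> mu.-integrable Rp (EFin \o profileK N v t).
  rewrite /= in_itv/= => /andP[t1 _]; apply: integrable_profileK; lra.
have dK' t y : `]x / 2, x + 1[%classic t -> Rp y -> derivable (fun t => profileK N v t y) t 1.
  by move=> It Ry; have [] := dK t y It Ry.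
have bK t y : `]x / 2, x + 1[%classic t -> Rp y -> `|partial1of2 (profileK N v) t y| <= G y.
  move=> It Ry; rewrite partial1of2E; have [_ ->] := dK t y It Ry.
  apply: HG; last by rewrite -RplusE.
  by move: It; rewrite /= in_itv/= => /andP[t1 _]; exact: ltW.
split.
  exact: (derivable_under_integral measurable_Rplus Ix iK dK' G0 iG bK).
rewrite -derive1E (differentiation_under_integral measurable_Rplus Ix iK dK' G0 iG bK).
apply: eq_Rintegral => y; rewrite inE => Ry.
by rewrite partial1of2E; have [_ ->] := dK x y Ix Ry.
Qed.

Lemma profileJ_schur N (W : R) (C m x : R) (w : R -> R) :
  measurable_fun Rp w -> 0 < x -> 0 <= C ->
  (forall y, 0 < y -> `|W * profileK N v x y| <= C * (schurK m x y * `|w y|)) ->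
  (`|W * profileJ N v x|%:E <= C%:E * \int[mu]_(y in Rp) (schurK m x y * `|w y|)%:E)%E.
Proof.
move=> mw x0 C0 H.
have iK := integrable_profileK N x0.
rewrite /profileJ -RintegralZl//; last exact: measurable_Rplus.
have iWK : mu.-integrable Rp (EFin \o (fun y => W * profileK N v x y)).
  by apply: (integrableZl measurable_Rplus W iK).
rewrite EFin_normr_Rintegral//; last exact: measurable_Rplus.
have mS : measurable_fun Rp (fun y => schurK m x y * `|w y|).
  apply: measurable_funM; first by apply: measurable_funTS; exact: measurable_schurK.
  exact: (measurableT_comp (@normr_measurable R setT) mw).
rewrite -ge0_integralZl_Rplus//; last by move=> y _; rewrite mulr_ge0 ?schurK_ge0.
apply: (le_trans (le_abse_integral _ measurable_Rplus _)).
  by have /integrableP[] := iWK.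
apply: ge0_le_integral_Rplus => //.
- apply: (measurableT_comp (@normr_measurable R setT)).
  by apply: measurable_funM; [exact: measurable_cst|exact: measurable_profileK].
- by apply: measurable_funM; [exact: measurable_cst|].
Qed.

Lemma schurK_dominates (delta x y : R) : 0 <= delta < alpha / 2 -> 0 < x -> 0 < y ->
  x `^ (rho_ alpha - delta) * y `^ (rho_ alpha + delta) * (x + y) `^ (- alpha) <=
  4 * schurK (alpha / 2 - delta) x y.
Proof.
move=> /andP[d0 da] x0 y0; set m := alpha / 2 - delta.
have m0 : 0 < m by rewrite /m; lra.
have xy0 : 0 < x + y by rewrite addr_gt0.
have E1 : rho_ alpha - delta = m - 2^-1 by rewrite /rho_ /m; field.
have E2 : y `^ (rho_ alpha + delta) = y `^ (m - 2^-1) * y `^ (2 * delta).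
  by rewrite -powRD ?(gt_eqF y0) ?implybT//; congr powR; rewrite /rho_ /m; field.
have E3 : (x + y) `^ (- (2 * m)) = (x + y) `^ (2 * delta) * (x + y) `^ (- alpha).
  by rewrite -powRD ?(gt_eqF xy0) ?implybT//; congr powR; rewrite /m; field.
rewrite E1 E2 /schurK.
have -> : 4 * (x `^ (m - 2^-1) * y `^ (m - 2^-1) * (x `^ m + y `^ m) `^ (-2)) =
  x `^ (m - 2^-1) * y `^ (m - 2^-1) * (4 * (x `^ m + y `^ m) `^ (-2)) by ring.
rewrite mulrA -[leLHS]mulrA ler_wpM2l ?mulr_ge0 ?powR_ge0//.
apply: le_trans (powR_add_le (ltW m0) x0 y0); rewrite E3 ler_wpM2r ?powR_ge0//.
by apply: ge0_ler_powR; rewrite ?nnegrE ?mulr_ge0//; lra.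
Qed.

Lemma profileJ_bound_weight N (delta : R) : (1 <= N)%N -> 0 <= delta < alpha / 2 ->
  exists2 C : R, 0 <= C & forall x, 0 < x ->
  (`|x `^ (- delta) * x `^ rho_ alpha * profileJ N v x|%:E <=
   C%:E * \int[mu]_(y in Rp) (schurK (alpha / 2 - delta) x y *
      `|y `^ (- N%:R + 1 - delta) * v y|)%:E)%E.
Proof.
move=> N1 hd; have [C C0 HC] := derive1n_r_bound N a1.
exists (C * 4) => [|x x0]; first by rewrite mulr_ge0.
apply: profileJ_schur => //; last 1 first.
- move=> y y0; have xy0 : 0 < x + y by rewrite addr_gt0.
  have [_ H] := HC _ xy0; have S := schurK_dominates hd x0 y0.
  rewrite /profileK !normrM !(ger0_norm (powR_ge0 _ _)).
  have pD (z s t : R) : 0 < z -> z `^ (s + t) = z `^ s * z `^ t.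
    by move=> z0; rewrite powRD// (gt_eqF z0) implybT.
  set d := `|derive1n _ _ _| in H *; set vy := `|v y|.
  have d0 : 0 <= d by exact: normr_ge0.
  have vy0 : 0 <= vy by exact: normr_ge0.
  have -> : x `^ (- delta) * x `^ rho_ alpha * (y `^ rho_ alpha * d * vy) =
     x `^ (rho_ alpha - delta) * y `^ (rho_ alpha + delta) *
      (y `^ (N%:R - 1) * d) * (y `^ (- N%:R + 1 - delta) * vy).
    have Ey : y `^ rho_ alpha =
        y `^ (rho_ alpha + delta) * (y `^ (N%:R - 1) * y `^ (- N%:R + 1 - delta)).
      by rewrite -!pD//; congr powR; ring.
    by rewrite Ey (pD x)//; ring.
  rewrite [leRHS]mulrA ler_wpM2r ?mulr_ge0 ?powR_ge0//.
  apply: (@le_trans _ _ (x `^ (rho_ alpha - delta) * y `^ (rho_ alpha + delta) *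
       (C * (x + y) `^ (- alpha)))).
    rewrite ler_wpM2l ?mulr_ge0 ?powR_ge0//.
    apply: (@le_trans _ _ ((x + y) `^ (N%:R - 1) * (C * (x + y) `^ (1 - alpha - N%:R)))).
      apply: ler_pM; rewrite ?powR_ge0//.
      apply: ge0_ler_powR; rewrite ?nnegrE ?(ltW y0) ?(ltW xy0)//.
        by rewrite subr_ge0 ler1n.
      by rewrite lerDr ltW.
    rewrite mulrCA ler_wpM2l// -pD// le_eqVlt; apply/orP; left; apply/eqP.
    by congr powR; ring.
  set pq := x `^ _ * y `^ _ in S *.
  have -> : pq * (C * (x + y) `^ (- alpha)) = C * (pq * (x + y) `^ (- alpha)) by ring.
  by rewrite -[leRHS]mulrA ler_wpM2l.
- by apply: measurable_funM => //; apply: measurable_funTS; exact: measurable_powR.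
- by rewrite mulr_ge0.
Qed.
End Operator.

Lemma profileJ_bound_power (alpha : R) N : 1 < alpha -> exists2 C : R, 0 <= C &
  forall v, measurable_fun Rp v ->
  (\int[mu]_(y in Rp) (v y ^+ 2)%:E < +oo)%E -> forall x, 0 < x ->
  (`|x ^+ N * x `^ rho_ alpha * profileJ alpha N v x|%:E <=
   C%:E * \int[mu]_(y in Rp) (schurK (alpha / 2) x y * `|v y|)%:E)%E.
Proof.
move=> a1; have [C C0 HC] := derive1n_r_bound N a1.
exists (C * 4) => [|v mv v2 x x0]; first by rewrite mulr_ge0.
apply: profileJ_schur => //; first by rewrite mulr_ge0.
move=> y y0; have xy0 : 0 < x + y by rewrite addr_gt0.
have [H _] := HC _ xy0.
have alpha0 : 0 < alpha by exact: lt_trans a1.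
have hd : 0 <= (0 : R) < alpha / 2 by rewrite lexx divr_gt0.
have := schurK_dominates hd x0 y0; rewrite subr0 addr0 subr0 => S.
rewrite /profileK !normrM !(ger0_norm (powR_ge0 _ _)) ger0_norm ?exprn_ge0 ?(ltW x0)//.
set p := x `^ _ in S *; set q := y `^ _ in S *.
have -> : x ^+ N * p * (q * `|derive1n N (r_ alpha) (x + y)| * `|v y|) =
  p * q * (x ^+ N * `|derive1n N (r_ alpha) (x + y)|) * `|v y| by ring.
rewrite [leRHS]mulrA ler_wpM2r//.
have pq0 : 0 <= p * q by rewrite mulr_ge0 ?powR_ge0.
apply: (@le_trans _ _ (p * q * (C * (x + y) `^ (- alpha)))).
  rewrite ler_wpM2l//.
  apply: (@le_trans _ _ ((x + y) ^+ N * (C * (x + y) `^ (- alpha - N%:R)))).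
    apply: ler_pM => //; first by rewrite exprn_ge0// ltW.
    by rewrite lerXn2r ?nnegrE ?(ltW x0) ?(ltW xy0)// lerDl ltW.
  rewrite mulrCA ler_wpM2l// powRD ?(gt_eqF xy0) ?implybT// powR_invn ?(ltW xy0)//.
  by rewrite mulrCA divff ?mulr1// expf_neq0// gt_eqF.
have -> : p * q * (C * (x + y) `^ (- alpha)) = C * (p * q * (x + y) `^ (- alpha)) by ring.
by rewrite -[leRHS]mulrA ler_wpM2l.
Qed.

End RealOperator.

Section ComplexL2.
Context {R : realType}.
Notation mu := (@lebesgue_measure R).
Notation Rp := (@Rplus R).
Implicit Types (u : R -> R[i]) (x y : R).

Lemma Re_scale (a : R) (z : R[i]) : complex.Re (a%:C * z) = a * complex.Re z.
Proof. by case: z => p q /=; rewrite mul0r subr0. Qed.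

Lemma Im_scale (a : R) (z : R[i]) : complex.Im (a%:C * z) = a * complex.Im z.
Proof. by case: z => p q /=; rewrite mul0r addr0. Qed.

Definition energy u : \bar R :=
  (\int[mu]_(x in Rp) (complex.Re (u x) ^+ 2)%:E +
   \int[mu]_(x in Rp) (complex.Im (u x) ^+ 2)%:E)%E.

Lemma energy_ge0 u : (0 <= energy u)%E.
Proof. by apply: adde_ge0; apply: integral_ge0 => x _; rewrite lee_fin sqr_ge0. Qed.

Lemma L2norm_energy u : measurable_fun Rp (fun x => complex.Re (u x)) ->
  measurable_fun Rp (fun x => complex.Im (u x)) ->
  L2norm u = (energy u `^ (2^-1))%E.
Proof.
move=> mr mi; rewrite /L2norm unlock; congr (_ `^ _)%E.
rewrite /energy -ge0_integralD; last 5 first.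
- exact: measurable_Rplus.
- by move=> x _; rewrite lee_fin sqr_ge0.
- by apply/measurable_EFinP; exact: measurable_funX.
- by move=> x _; rewrite lee_fin sqr_ge0.
- by apply/measurable_EFinP; exact: measurable_funX.
rewrite [RHS]integral_mkcond; apply: eq_integral => x _ /=.
rewrite !patchE; case: ifPn => _; last by rewrite abse0 poweR0r// pnatr_eq0.
rewrite abse_EFin poweR_EFin -EFinD; congr EFin.
rewrite -[2]/(2%:R) powR_mulrn// real_normK ?num_real//.
by case: (u x) => p q /=; rewrite sqr_sqrtr// addr_ge0 ?sqr_ge0.
Qed.

Lemma inL2P u : inL2 u <->
  [/\ measurable_fun Rp (fun x => complex.Re (u x)),
      measurable_fun Rp (fun x => complex.Im (u x)),
      (\int[mu]_(x in Rp) (complex.Re (u x) ^+ 2)%:E < +oo)%E &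
      (\int[mu]_(x in Rp) (complex.Im (u x) ^+ 2)%:E < +oo)%E].
Proof.
have re0 : (0 <= \int[mu]_(x in Rp) (complex.Re (u x) ^+ 2)%:E)%E.
  by apply: integral_ge0 => x _; rewrite lee_fin sqr_ge0.
have im0 : (0 <= \int[mu]_(x in Rp) (complex.Im (u x) ^+ 2)%:E)%E.
  by apply: integral_ge0 => x _; rewrite lee_fin sqr_ge0.
split=> [[mr mi]|[mr mi fr fi]].
- rewrite L2norm_energy// => /lty_poweRy fin.
  have {}fin : (energy u < +oo)%E by apply: fin; rewrite invr_eq0 pnatr_eq0.
  by split=> //; apply: le_lt_trans fin; rewrite /energy ?leeDl ?leeDr.
- split=> //; rewrite L2norm_energy//; apply: poweR_lty.
  exact: lte_add_pinfty.
Qed.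

Variables (alpha : R) (a1 : 1 < alpha).
Let rho := rho_ alpha.
Let PR (N : nat) (u : R -> R[i]) : R -> R[i] := iter N (opP rho) (opR alpha u).
Let re u x := complex.Re (u x).
Let im u x := complex.Im (u x).

Lemma kernelR_profileK v x y : 0 < x -> 0 < y ->
  kernelR alpha x y * v y = x `^ rho * profileK alpha 0 v x y.
Proof.
by move=> x0 y0; rewrite /kernelR /profileK powRM ?(ltW x0) ?(ltW y0)//= -/rho; ring.
Qed.

Lemma integrable_kernelR (v : R -> R) x : measurable_fun Rp v ->
  (\int[mu]_(y in Rp) (v y ^+ 2)%:E < +oo)%E -> 0 < x ->
  mu.-integrable Rp (fun y => (kernelR alpha x y * v y)%:E).
Proof.
move=> mv fv x0; have iK := integrable_profileK a1 mv fv 0 x0.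
apply: eq_integrable (integrableZl measurable_Rplus (x `^ rho) iK) => //.
  exact: measurable_Rplus.
by move=> y; rewrite inE RplusE => y0 /=; rewrite kernelR_profileK.
Qed.

Lemma Rintegral_kernelR (v : R -> R) x : measurable_fun Rp v ->
  (\int[mu]_(y in Rp) (v y ^+ 2)%:E < +oo)%E -> 0 < x ->
  (\int[mu]_(y in Rp) (kernelR alpha x y * v y))%R = x `^ rho * profileJ alpha 0 v x.
Proof.
move=> mv fv x0; have iK := integrable_profileK a1 mv fv 0 x0.
rewrite /profileJ -RintegralZl//; last exact: measurable_Rplus.
by apply: eq_Rintegral => y; rewrite inE RplusE => y0; rewrite kernelR_profileK.
Qed.

Lemma is_derive_scaled_profileJ (v : R -> R) N x : measurable_fun Rp v ->
  (\int[mu]_(y in Rp) (v y ^+ 2)%:E < +oo)%E -> 0 < x ->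
  is_derive x 1 (fun y => y `^ rho * profileJ alpha N v y)
    (x `^ rho * profileJ alpha N.+1 v x + rho / x * (x `^ rho * profileJ alpha N v x)).
Proof.
move=> mv fv x0.
have := is_derive_mul (is_derive1_powR rho x0) (is_derive_profileJ a1 mv fv N x0).
move/is_derive_eq; apply.
rewrite powRB ?(gt_eqF x0) ?implybT// powRr1 ?(ltW x0)//.
by field; rewrite gt_eqF.
Qed.

Lemma iter_opP N u x : inL2 u -> 0 < x ->
  re (PR N u) x = x `^ rho * profileJ alpha N (re u) x /\
  im (PR N u) x = x `^ rho * profileJ alpha N (im u) x.
Proof.
move=> /inL2P[mr mi fr fi]; elim: N x => [|N IH] x x0.
  rewrite /PR/= /opR /Cintegral /re /im /=; split.
    rewrite -(Rintegral_kernelR mr fr x0).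
    by apply: eq_Rintegral => y _; rewrite Re_scale.
  rewrite -(Rintegral_kernelR mi fi x0).
  by apply: eq_Rintegral => y _; rewrite Im_scale.
have Hr t : 0 < t -> t `^ rho * profileJ alpha N (re u) t = re (PR N u) t.
  by move=> t0; have [->] := IH t t0.
have Hi t : 0 < t -> t `^ rho * profileJ alpha N (im u) t = im (PR N u) t.
  by move=> t0; have [_ ->] := IH t t0.
have Dr := is_derive_ext x0 Hr (is_derive_scaled_profileJ N mr fr x0).
have Di := is_derive_ext x0 Hi (is_derive_scaled_profileJ N mi fi x0).
have [Er Ei] := IH x x0.
rewrite /PR iterS -/(PR N u) /opP {1}/re {1}/im !raddfB /= Re_scale Im_scale.
rewrite -/(re _ x) -/(im _ x) Er Ei.
split.
- by rewrite derive1E; have [_ ->] := Dr; ring.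
- by rewrite derive1E; have [_ ->] := Di; ring.
Qed.

Lemma derivable_iter_opP N u x : inL2 u -> 0 < x ->
  derivable (re (PR N u)) x 1 /\ derivable (im (PR N u)) x 1.
Proof.
move=> Lu x0; have /inL2P[mr mi fr fi] := Lu; split.
- have H t : 0 < t -> t `^ rho * profileJ alpha N (re u) t = re (PR N u) t.
    by move=> t0; have [->] := iter_opP N Lu t0.
  by have [] := is_derive_ext x0 H (is_derive_scaled_profileJ N mr fr x0).
- have H t : 0 < t -> t `^ rho * profileJ alpha N (im u) t = im (PR N u) t.
    by move=> t0; have [_ ->] := iter_opP N Lu t0.
  by have [] := is_derive_ext x0 H (is_derive_scaled_profileJ N mi fi x0).
Qed.

Lemma measurable_iter_opP N u : inL2 u ->
  measurable_fun Rp (re (PR N u)) /\ measurable_fun Rp (im (PR N u)).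
Proof.
move=> Lu; split; apply: continuous_measurable_Rplus => x x0;
  apply: derivable_continuous; by have [] := derivable_iter_opP N Lu x0.
Qed.

Lemma weighted_iter_opP_energy (W : R -> R) N u (m C : R) (w1 w2 : R -> R) :
  inL2 u -> 0 < m -> 0 <= C -> measurable_fun Rp W ->
  measurable_fun Rp w1 -> measurable_fun Rp w2 ->
  (forall x, 0 < x -> (`|W x * x `^ rho * profileJ alpha N (re u) x|%:E <=
    C%:E * \int[mu]_(y in Rp) (schurK m x y * `|w1 y|)%:E)%E) ->
  (forall x, 0 < x -> (`|W x * x `^ rho * profileJ alpha N (im u) x|%:E <=
    C%:E * \int[mu]_(y in Rp) (schurK m x y * `|w2 y|)%:E)%E) ->
  [/\ measurable_fun Rp (re (fun x => (W x)%:C * PR N u x)),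
      measurable_fun Rp (im (fun x => (W x)%:C * PR N u x)),
      (\int[mu]_(x in Rp) (re (fun x => (W x)%:C * PR N u x) x ^+ 2)%:E <=
        (C ^+ 2 / m ^+ 2)%:E * \int[mu]_(x in Rp) (w1 x ^+ 2)%:E)%E &
      (\int[mu]_(x in Rp) (im (fun x => (W x)%:C * PR N u x) x ^+ 2)%:E <=
        (C ^+ 2 / m ^+ 2)%:E * \int[mu]_(x in Rp) (w2 x ^+ 2)%:E)%E].
Proof.
move=> Lu m0 C0 mW mw1 mw2 H1 H2.
have [mr mi] := measurable_iter_opP N Lu.
have Er : re (fun x => (W x)%:C * PR N u x) = (fun x => W x * re (PR N u) x).
  by apply/funext => x; rewrite /re Re_scale.
have Ei : im (fun x => (W x)%:C * PR N u x) = (fun x => W x * im (PR N u) x).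
  by apply/funext => x; rewrite /im Im_scale.
have mWr : measurable_fun Rp (fun x => W x * re (PR N u) x) by exact: measurable_funM.
have mWi : measurable_fun Rp (fun x => W x * im (PR N u) x) by exact: measurable_funM.
rewrite Er Ei; split=> //.
- apply: schur_test => // x x0; have [-> _] := iter_opP N Lu x0.
  by rewrite mulrA; exact: H1.
- apply: schur_test => // x x0; have [_ ->] := iter_opP N Lu x0.
  by rewrite mulrA; exact: H2.
Qed.

Lemma weighted_iter_opP_inL2 N (delta : R) u : (1 <= N)%N -> 0 <= delta < alpha / 2 ->
  inL2 u -> inL2 (fun x => (x `^ (- N%:R + 1 - delta))%:C * u x) ->
  inL2 (fun x => (x `^ (- delta))%:C * PR N u x).
Proof.
move=> N1 hd Lu /inL2P[mwr mwi fwr fwi]; have /inL2P[mr mi fr fi] := Lu.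
have m0 : 0 < alpha / 2 - delta by rewrite subr_gt0; case/andP: hd.
have [C1 C10 H1] := profileJ_bound_weight a1 mr fr N1 hd.
have [C2 C20 H2] := profileJ_bound_weight a1 mi fi N1 hd.
have wr : (fun x => complex.Re ((x `^ (- N%:R + 1 - delta))%:C * u x)) =
   (fun x => x `^ (- N%:R + 1 - delta) * re u x).
  by apply/funext => x; rewrite Re_scale.
have wi : (fun x => complex.Im ((x `^ (- N%:R + 1 - delta))%:C * u x)) =
   (fun x => x `^ (- N%:R + 1 - delta) * im u x).
  by apply/funext => x; rewrite Im_scale.
rewrite wr in mwr; rewrite wi in mwi.
have up (a b : R) (I t : \bar R) :
    (0 <= I)%E -> (t <= a%:E * I)%E -> a <= b -> (t <= b%:E * I)%E.
  by move=> I0 H ab; apply: (le_trans H); rewrite lee_wpmul2r// lee_fin.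
have I0 x (w : R -> R) :
    (0 <= \int[mu]_(y in Rp) (schurK (alpha / 2 - delta) x y * `|w y|)%:E)%E.
  by apply: integral_ge0 => y _; rewrite lee_fin mulr_ge0 ?schurK_ge0.
have [||x x0|x x0|? ? B1 B2] := @weighted_iter_opP_energy (fun x => x `^ (- delta))
  N u _ (C1 + C2) _ _ Lu m0 _ _ mwr mwi.
- exact: addr_ge0.
- by apply: measurable_funTS; exact: measurable_powR.
- by apply: up (H1 x x0) _ => //; rewrite lerDl.
- by apply: up (H2 x x0) _ => //; rewrite lerDr.
apply/inL2P; split=> //.
- apply: (le_lt_trans B1); apply: lte_mul_pinfty => //.
  + by rewrite lee_fin divr_ge0 ?sqr_ge0.
  + by move: fwr; under eq_integral do rewrite Re_scale.
- apply: (le_lt_trans B2); apply: lte_mul_pinfty => //.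
  + by rewrite lee_fin divr_ge0 ?sqr_ge0.
  + by move: fwi; under eq_integral do rewrite Im_scale.
Qed.

Lemma power_iter_opP_bounded N : bounded_on_L2 (fun u x => (x ^+ N)%:C * PR N u x).
Proof.
have [C C0 H] := profileJ_bound_power N a1.
have alpha0 : 0 < alpha by exact: lt_trans a1.
have m0 : 0 < alpha / 2 by exact: divr_gt0.
set c := C ^+ 2 / (alpha / 2) ^+ 2.
have c0 : 0 <= c by rewrite divr_ge0 ?sqr_ge0.
exists (c `^ 2^-1) => u Lu; have /inL2P[mr mi fr fi] := Lu.
have mX : measurable_fun Rp (fun x : R => x ^+ N).
  by apply: measurable_funTS; exact: measurable_funX.
have [mTr mTi B1 B2] := weighted_iter_opP_energy Lu m0 C0 mX mr mi (H _ mr fr) (H _ mi fi).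
split.
  by apply/inL2P; split=> //; [apply: (le_lt_trans B1)|apply: (le_lt_trans B2)];
    apply: lte_mul_pinfty.
rewrite !L2norm_energy// -poweR_EFin -poweRM ?lee_fin ?energy_ge0//.
apply: gt0_ler_poweR.
- by rewrite invr_ge0.
- by rewrite ?in_itv/= energy_ge0 leey.
- by rewrite ?in_itv/= mule_ge0 ?energy_ge0 ?lee_fin// leey.
rewrite /energy ge0_muleDr; first exact: leeD.
- by apply: integral_ge0 => x _; rewrite lee_fin sqr_ge0.
- by apply: integral_ge0 => x _; rewrite lee_fin sqr_ge0.
Qed.
End ComplexL2.

Unset Implicit Arguments.

(* The first conjunct says that R_alpha u and all P_rho^N R_alpha u are
   genuinely defined pointwise on (0, oo), so that the totalized integral and
   derivative in opR and opP have their usual meaning in the other two. *)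
Theorem lemma5p1 (R : realType) (alpha : R) (halpha : 1 < alpha) :
  let PR (N : nat) (u : R -> R[i]) : R -> R[i] :=
    iter N (opP (rho_ alpha)) (opR alpha u) in
  [/\ forall u : R -> R[i], inL2 u -> forall x : R, 0 < x ->
        Cintegrable Rplus (fun y => (kernelR alpha x y)%:C * u y) /\
        (forall N : nat, Cderivable (PR N u) x),
      forall (N : nat) (delta : R), (1 <= N)%N -> 0 <= delta < alpha / 2 ->
        forall u : R -> R[i], inL2 u ->
          inL2 (fun x => (x `^ (- N%:R + 1 - delta))%:C * u x) ->
          inL2 (fun x => (x `^ (- delta))%:C * PR N u x) &
      forall N : nat, (1 <= N)%N ->
        bounded_on_L2 (fun u x => (x ^+ N)%:C * PR N u x)].
Proof.
move=> PR; split.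
- move=> u Lu x x0; have /inL2P[mr mi fr fi] := Lu; split; last first.
    by move=> N; exact: (derivable_iter_opP halpha N Lu x0).
  rewrite /Cintegrable; split.
    by under eq_fun do rewrite Re_scale; exact: integrable_kernelR.
  by under eq_fun do rewrite Im_scale; exact: integrable_kernelR.
- by move=> N delta N1 hd u Lu Lw; exact: weighted_iter_opP_inL2.
- by move=> N _; exact: power_iter_opP_bounded.
Qed.
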